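(* Let $\alpha\in(0,1)$, let $Z_\alpha$ and $Z_\alpha'$ be two independent positive $\alpha$-stable random variables with the same law, and let $Y_\alpha=Z_\alpha/Z_\alpha'$. Then $Y_\alpha$ is hyperbolically completely monotone (HCM) if and only if $\alpha\le 1/2$.
   Context: For $\alpha\in(0,1)$, a positive $\alpha$-stable random variable $Z_\alpha$ is normalized by $\mathbb{E}[e^{-\lambda Z_\alpha}]=e^{-\lambda^\alpha}$ for all $\lambda\ge 0$. A function $f:(0,\infty)\to(0,\infty)$ is called hyperbolically completely monotone (HCM) if for every $u>0$ the function $H_u(w)=f(uv)f(u/v)$, where $w=v+1/v\ge 2$, $v>0$ (this expression always depends on $v$ only through $w$), is completely monotone in the variable $w$. A positive random variable is called HCM if it has a density on $(0,\infty)$ which is an HCM function. A function is completely monotone if all its derivatives of order $n\ge0$ have sign $(-1)^n$ (in the weak sense). *)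

(* Defs.v *)
From HB Require Import structures.
From mathcomp Require Import all_boot all_order all_algebra.
From mathcomp Require Import all_classical all_reals all_analysis.
From mathcomp Require Import measurable_realfun.

Set Implicit Arguments.
Unset Strict Implicit.
Unset Printing Implicit Defensive.

Import Order.TTheory GRing.Theory Num.Theory.
Import numFieldNormedType.Exports.

Local Open Scope classical_set_scope.
Local Open Scope ring_scope.

(* Complete monotonicity on the closed half-line [a, +oo[, in Widder's sense:
   smooth with alternating signs in the interior, continuous up to [a].
   The values of [h] on ]-oo, a[ are irrelevant. *)
Definition completely_monotone (R : realType) (a : R) (h : R -> R) : Prop :=
  {within `[a, +oo[, continuous h} /\
  forall (n : nat) (x : R), a < x ->
    derivable (derive1n n h) x 1 /\ 0 <= (-1) ^+ n * derive1n n h x.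

(* A function ]0, +oo[ -> ]0, +oo[ is represented by a total [f : R -> R] whose
   values on ]-oo, 0] are irrelevant.  Since v |-> v + v^-1 maps ]0, +oo[ onto
   [2, +oo[, the function [H] below is uniquely determined on [2, +oo[; it
   exists because f(uv) f(u/v) is invariant under v |-> v^-1. *)
Definition hcm_function (R : realType) (f : R -> R) : Prop :=
  (forall x : R, 0 < x -> 0 < f x) /\
  forall u : R, 0 < u ->
    exists H : R -> R,
      (forall v : R, 0 < v -> H (v + v^-1) = f (u * v) * f (u / v)) /\
      completely_monotone 2 H.

(* Taking A = ]0, +oo[ and A = setT shows that X is positive almost surely. *)
Definition has_density_on_pos (d : measure_display) (T : measurableType d)
    (R : realType) (P : probability T R) (X : {RV P >-> R}) (f : R -> R)
    : Prop :=
  measurable_fun (`]0, +oo[ : set R) f /\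
  forall A : set R, measurable A ->
    distribution P X A
    = (\int[lebesgue_measure]_(x in (A `&` `]0%R, +oo[)) (f x)%:E)%E.

Definition hcm_RV (d : measure_display) (T : measurableType d)
    (R : realType) (P : probability T R) (X : {RV P >-> R}) : Prop :=
  exists f : R -> R, has_density_on_pos X f /\ hcm_function f.

(* The Laplace transform determines the law, stability included. *)
Definition positive_stable (d : measure_display) (T : measurableType d)
    (R : realType) (P : probability T R) (alpha : R) (Z : {RV P >-> R})
    : Prop :=
  {ae P, forall t, 0 < Z t} /\
  forall l : R, 0 <= l ->
    'E_P[fun t => expR (- (l * Z t))]%E = (expR (- (l `^ alpha)))%:E.

Definition independent_RV (d : measure_display) (T : measurableType d)
    (R : realType) (P : probability T R) (X Y : {RV P >-> R}) : Prop :=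
  forall A B : set R, measurable A -> measurable B ->
    P (X @^-1` A `&` Y @^-1` B) = (P (X @^-1` A) * P (Y @^-1` B))%E.

(* Equality is only required on measurable sets: the value of a measure at a
   non-measurable set is unspecified. *)
Definition same_law (d : measure_display) (T : measurableType d)
    (R : realType) (P : probability T R) (X Y : {RV P >-> R}) : Prop :=
  forall A : set R, measurable A -> distribution P X A = distribution P Y A.

Lemma measurable_inv_real (R : realType) :
  measurable_fun [set: R] (@GRing.inv R).
Proof.
have -> : [set: R] = [set 0] `|` ~` [set 0] by rewrite setUv.
have m0 : measurable [set (0 : R)] by exact: measurable_set1.
apply/(measurable_funU _ m0 (measurableC m0)); split.
- exact: measurable_fun_set1.
- apply: open_continuous_measurable_fun.
  + apply/closed_openC/accessible_closed_set1/hausdorff_accessible.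
    exact: Rhausdorff.
  + by move=> x /set_mem /eqP x0; exact: inv_continuous.
Qed.

Section ratio.
Context (d : measure_display) (T : measurableType d) (R : realType)
  (P : probability T R) (X Y : {RV P >-> R}).

Definition ratio_fun : T -> R := fun t => X t / Y t.

Let measurable_ratio_fun : measurable_fun [set: T] ratio_fun.
Proof.
apply: measurable_funM; first exact: measurable_funPT.
by apply: (measurableT_comp (@measurable_inv_real R)); exact: measurable_funPT.
Qed.

HB.instance Definition _ :=
  isMeasurableFun.Build _ _ _ _ ratio_fun measurable_ratio_fun.

Definition ratio_RV : {RV P >-> R} := ratio_fun.

End ratio.

(* Main.v *)
(* Write f(x) = sin(pi alpha)/pi x^(alpha-1) / D(x^alpha) with
   D(t) = t^2 + 2 cos(pi alpha) t + 1.

   f is the density of Y = Z/Z': since U/(U + sV) = \int_0^oo U e^(-tU) e^(-tsV) dt and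
   E[Z e^(-tZ)] = alpha t^(alpha-1) e^(-t^alpha), independence gives
   E[Y/(Y + s)] = 1/(1 + s^alpha).  A contour integral over the strip 0 <= Im z <= pi
   (x = s e^y being the logarithmic coordinate on the ray) shows that f has the same
   transform, and this Stieltjes transform determines a probability law on ]0, +oo[.

   If alpha <= 1/2, then cos(pi alpha) >= 0, and f(uv) f(u/v) is a constant divided by a
   combination with nonnegative coefficients of 1 and of v^b + v^(-b) for b = alpha and
   b = 2 alpha.  As functions of w = v + 1/v these solve Chebyshev's equation
   (w^2 - 4) y'' + w y' = b^2 y, from which y' is completely monotone when 0 < b <= 1;
   hence so is the reciprocal of the combination.

   If alpha > 1/2 and Y had an HCM density g, then g(x) g(4x) <= g(2x)^2 for every x > 0,
   and g = f almost everywhere; but cos(pi alpha) < 0 makes the inequality fail for f at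
   every large x. *)

From HB Require Import structures.
Require Import Defs.
From mathcomp Require Import all_boot all_order all_algebra.
From mathcomp Require Import all_classical all_reals all_analysis.
From mathcomp Require Import measurable_realfun ring lra.

Set Implicit Arguments.
Unset Strict Implicit.
Unset Printing Implicit Defensive.

Import Order.TTheory GRing.Theory Num.Theory.
Import numFieldNormedType.Exports.

Local Open Scope classical_set_scope.
Local Open Scope ring_scope.

(** * Functions that are completely monotone up to a given order *)

(** The bound alpha <= 1/2 enters twice: it makes cos(pi alpha) nonnegative, and it keeps the larger
    exponent b = 2 alpha at most 1. A differentiated Chebyshev equation, multiplied by a power of
    sqrt(w^2 - 4), expresses an exact derivative through the preceding y^(n) with coefficient b^2 -
    n^2, n >= 1; b <= 1 fixes its sign. No contour is ever integrated over. The integral over 0 < t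
    <= pi of the real part of a holomorphic function of y + i t has, by Cauchy-Riemann, a difference
    of boundary imaginary parts as its derivative in y, so it is an antiderivative of the wanted
    integrand. With c = s^alpha the natural function is 1 / (1 + c e^(alpha z)) times 1 / (1 -
    e^(-z)). The second factor has a pole at z = 0, on the boundary of the strip; subtracting from
    the first factor its value at 0 removes it and leaves, up to the constant -c / (1 + c), the
    numerator e^(alpha z) - 1. The Stieltjes transform determines the law because it yields all
    moments of the bounded variable 1 / (x + 1). *)

Lemma near_cvg_eq (T : Type) (U : topologicalType) (F : set_system T)
    {FF : Filter F} (f g : T -> U) (l : U) :
  (\forall x \near F, f x = g x) -> f x @[x --> F] --> l -> g x @[x --> F] --> l.
Proof. by move=> fg; apply: cvg_trans; apply: near_eq_cvg. Qed.

Section cm_upto.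
Context (R : realType) (a : R).
Implicit Types (n : nat) (f g h k b : R -> R).

(** Each derivative is carried as a witness [k] with h' = - k, itself nonnegative. Closure under
    sums and products then follows by induction on the order, without Leibniz formulas for iterated
    derivatives. *)
Fixpoint cm_upto n h : Prop :=
  (forall x, a < x -> 0 <= h x) /\
  if n is m.+1 then
    exists2 k, (forall x, a < x -> is_derive x 1 h (- k x)) & cm_upto m k
  else True.

Lemma cm_uptoW n h : cm_upto n.+1 h -> cm_upto n h.
Proof.
elim: n h => [|n IH] h [h0 [k hk ck]]; split => //.
by exists k => //; exact: IH.
Qed.

Lemma cm_upto_cst n (c : R) : 0 <= c -> cm_upto n (fun=> c).
Proof.
elim: n c => [|n IH] c c0; split => //.
exists (fun=> 0); last exact: IH.
by move=> x _; rewrite oppr0; exact: is_derive_cst.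
Qed.

Lemma cm_uptoD n f g : cm_upto n f -> cm_upto n g ->
  cm_upto n (fun x => f x + g x).
Proof.
elim: n f g => [|n IH] f g [f0 cf] [g0 cg]; split => //.
- by move=> x ax; rewrite addr_ge0 ?f0 ?g0.
- by move=> x ax; rewrite addr_ge0 ?f0 ?g0.
case: cf cg => [f' df cf] [g' dg cg].
exists (fun x => f' x + g' x); last exact: IH.
by move=> x ax; rewrite opprD; have := df x ax; have := dg x ax; move=> *; exact: is_deriveD.
Qed.

Lemma cm_uptoM n f g : cm_upto n f -> cm_upto n g ->
  cm_upto n (fun x => f x * g x).
Proof.
elim: n f g => [|n IH] f g cf0 cg0; case: (cf0) (cg0) => [f0 cf] [g0 cg]; split => //.
- by move=> x ax; rewrite mulr_ge0 ?f0 ?g0.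
- by move=> x ax; rewrite mulr_ge0 ?f0 ?g0.
case: cf cg => [f' df cf] [g' dg cg].
exists (fun x => f x * g' x + f' x * g x); last first.
  by apply: cm_uptoD; apply: IH => //; exact: cm_uptoW.
move=> x ax; have := df x ax; have := dg x ax => dgx dfx.
apply: is_derive_eq; rewrite /GRing.scale/=; ring.
Qed.

(* The derivative of [b^-1] is [- k b^-1 b^-1], a product of functions already
   known to be completely monotone up to the previous order. *)
Lemma cm_upto_inv b k : (forall x, a < x -> 0 < b x) ->
  (forall x, a < x -> is_derive x 1 b (k x)) -> (forall n, cm_upto n k) ->
  forall n, cm_upto n (fun x => (b x)^-1).
Proof.
move=> b0 db ck; elim=> [|n IH]; split => //; try by move=> x ax; rewrite invr_ge0 ltW// b0.
exists (fun x => k x * ((b x)^-1 * (b x)^-1)); last by do 2?apply: cm_uptoM.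
move=> x ax; have dbx := db x ax; have bx := b0 x ax.
apply: is_derive_eq; first by apply: is_deriveV; rewrite gt_eqF.
by rewrite /GRing.scale/=; field; rewrite gt_eqF.
Qed.

Lemma near_eq_gt x f g : a < x -> (forall y, a < y -> f y = g y) ->
  {near x, f =1 g}.
Proof.
by move=> ax fg; near=> y; apply: fg; near: y; exact: lt_nbhsr.
Unshelve. all: by end_near. Qed.

(** Passes from the witnesses to [derive1n]. The two agree up to sign only on a < x, so derivatives
    are compared through local equality. The order is n + 1 because the n-th derivative must itself
    be derivable. *)
Lemma cm_upto_derive1n n h x : cm_upto n.+1 h -> a < x ->
  derivable (derive1n n h) x 1 /\ 0 <= (-1) ^+ n * derive1n n h x.
Proof.
have main : forall m h, cm_upto n.+1 h -> (m <= n)%N -> exists2 k,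
    (forall x, a < x -> derive1n m h x = (-1) ^+ m * k x) & cm_upto (n - m).+1 k.
  elim=> [|m IH] {}h ch mn.
    by exists h; [move=> y ay; rewrite expr0 mul1r|rewrite subn0].
  have [k hk ck] := IH _ ch (ltnW mn).
  case: ck => k0 [k' dk ck].
  exists k'; last by rewrite subnSK.
  move=> y ay; rewrite derive1nS derive1E.
  rewrite (near_eq_derive (g := fun x => (-1) ^+ m * k x)) ?oner_eq0//; last first.
    exact: near_eq_gt.
  have dky := dk y ay; rewrite derive_val /GRing.scale/= exprS; ring.
move=> ch ax; have [k hk ck] := main n h ch (leqnn _).
case: ck => k0; rewrite subnn => -[k' dk _].
split.
- apply: (near_eq_derivable (f := fun x => (-1) ^+ n * k x)); rewrite ?oner_eq0//.
    by apply: near_eq_gt ax _ => y ay; rewrite hk.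
  by have dkx := dk x ax; exact: ex_derive.
- by rewrite hk// mulrA -expr2 sqrr_sign mul1r k0.
Qed.

End cm_upto.

(** * Derivatives of v^b + v^(-b) in the variable v + 1/v *)

Section chebyshev.
Context (R : realType).
Implicit Types (w beta : R) (n : nat).

(** For w = v + 1/v this is |v - 1/v|, and [joukowski_inv] is the branch v >= 1 of the inverse, with
    dv/dw = v / sqrt(w^2 - 4). *)
Definition joukowski_sqrt w : R := Num.sqrt (w ^+ 2 - 4).
Definition joukowski_inv w : R := (w + joukowski_sqrt w) / 2.
Local Notation rt := joukowski_sqrt.
Local Notation vv := joukowski_inv.

Lemma joukowski_sqrt_gt0 w : 2 < w -> 0 < rt w.
Proof. by move=> w2; rewrite sqrtr_gt0 subr_gt0; nra. Qed.

Lemma sqr_joukowski_sqrt w : 2 <= w -> rt w ^+ 2 = w ^+ 2 - 4.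
Proof. by move=> w2; rewrite sqr_sqrtr// subr_ge0; nra. Qed.

Lemma joukowski_inv_gt0 w : 2 <= w -> 0 < vv w.
Proof. by move=> w2; rewrite divr_gt0// ltr_wpDr// ?sqrtr_ge0//; lra. Qed.

Lemma joukowski_invK v : 0 < v -> vv (v + v^-1) = v \/ vv (v + v^-1) = v^-1.
Proof.
move=> v0; have v'0 : 0 < v^-1 by rewrite invr_gt0.
have e : (v + v^-1) ^+ 2 - 4 = (v - v^-1) ^+ 2 by field; rewrite gt_eqF.
rewrite /vv /rt e sqrtr_sqr; have [h|h] := leP v v^-1.
- by right; rewrite ler0_norm ?subr_le0//; field; rewrite gt_eqF.
- by left; rewrite gtr0_norm ?subr_gt0//; field; rewrite gt_eqF.
Qed.

Lemma continuous_joukowski_sqrt : continuous rt.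
Proof.
move=> w; apply: (@continuous_comp _ _ _ (fun w => w ^+ 2 - 4) Num.sqrt).
  by apply: cvgB; [exact: exprn_continuous|exact: cvg_cst].
exact: sqrt_continuous.
Qed.

Lemma continuous_joukowski_inv : continuous vv.
Proof.
move=> w; apply: cvgM; last exact: cvg_cst.
apply: cvgD; first exact: cvg_id.
exact: continuous_joukowski_sqrt.
Qed.

Lemma is_derive_joukowski_sqrt w : 2 < w -> is_derive w 1 rt (w / rt w).
Proof.
move=> w2; have r0 := joukowski_sqrt_gt0 w2.
have w0 : 0 < w ^+ 2 - 4 by move: r0; rewrite sqrtr_gt0.
have d1 : is_derive w 1 (fun w : R => w ^+ 2 - 4) (w *+ 2).
  by apply: is_derive_eq; rewrite /GRing.scale/=; ring.
have d2 := is_derive1_sqrt w0.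
have := @is_derive1_comp _ Num.sqrt (fun w : R => w ^+ 2 - 4) w _ _ d2 d1.
move=> d3; apply: (is_derive_eq d3).
by rewrite -/(rt w); field; rewrite gt_eqF.
Qed.

Lemma is_derive_joukowski_inv w : 2 < w -> is_derive w 1 vv (vv w / rt w).
Proof.
move=> w2; have r0 := joukowski_sqrt_gt0 w2.
have d := is_derive_joukowski_sqrt w2.
apply: is_derive_eq; rewrite /GRing.scale/= /vv; field; rewrite gt_eqF//.
Qed.

Lemma is_derive_joukowski_powR beta w : 2 < w ->
  is_derive w 1 (fun w => vv w `^ beta) (beta * vv w `^ beta / rt w).
Proof.
move=> w2; have r0 := joukowski_sqrt_gt0 w2.
have v0 := joukowski_inv_gt0 (ltW w2).
have d1 := is_derive_joukowski_inv w2.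
have d2 := is_derive1_powR beta v0.
have := @is_derive1_comp _ (fun x : R => x `^ beta) vv w _ _ d2 d1.
move=> d3; apply: (is_derive_eq d3).
have := @powRB R (vv w) beta 1; rewrite powRr1 ?(ltW v0)// => -> //.
  by field; rewrite !gt_eqF.
by rewrite (gt_eqF v0) implybT.
Qed.

End chebyshev.

Section chebyshev_derivatives.
Context (R : realType) (beta : R).
Local Notation rt := (@joukowski_sqrt R).
Local Notation vv := (@joukowski_inv R).
Implicit Types (w : R) (n : nat).

(** Two consecutive derivatives of 2 cosh(beta log v) = v^beta + v^(-beta) in the variable w,
    carried together because the recurrence has depth two. *)
Fixpoint cosh_pair n w : R * R :=
  if n is m.+1 then
    let: (y, y') := cosh_pair m w in
    (y', ((beta ^+ 2 - m%:R ^+ 2) * y - (m.*2.+1)%:R * w * y') / rt w ^+ 2)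
  else (vv w `^ beta + (vv w `^ beta)^-1,
        beta * (vv w `^ beta - (vv w `^ beta)^-1) / rt w).

Definition cosh_derivn n w := (cosh_pair n w).1.
Local Notation Y := cosh_derivn.

Lemma cosh_derivn0 w : Y 0 w = vv w `^ beta + (vv w `^ beta)^-1.
Proof. by []. Qed.

Lemma cosh_derivn1 w :
  Y 1 w = beta * (vv w `^ beta - (vv w `^ beta)^-1) / rt w.
Proof. by []. Qed.

(* The recurrence is the n-th derivative of Chebyshev's equation
   [(w^2 - 4) y'' + w y' = beta^2 y]. *)
Lemma cosh_derivnSS n w : Y n.+2 w =
  ((beta ^+ 2 - n%:R ^+ 2) * Y n w - (n.*2.+1)%:R * w * Y n.+1 w) / rt w ^+ 2.
Proof. by rewrite /cosh_derivn/=; case: (cosh_pair n w). Qed.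

Lemma is_derive_cosh_derivn n w : 2 < w -> is_derive w 1 (Y n) (Y n.+1 w).
Proof.
move=> w2; have r0 := joukowski_sqrt_gt0 w2.
have v0 := joukowski_inv_gt0 (ltW w2).
have p0 : 0 < vv w `^ beta by exact: powR_gt0.
have rE := sqr_joukowski_sqrt (ltW w2).
have dr := is_derive_joukowski_sqrt w2.
have dp := is_derive_joukowski_powR beta w2.
have dp' : is_derive w 1 (fun w => (vv w `^ beta)^-1)
    (- beta * (vv w `^ beta)^-1 / rt w).
  apply: (is_derive_eq (is_deriveV _ dp)); rewrite ?gt_eqF//.
  by rewrite /GRing.scale/=; field; rewrite !gt_eqF.
have dr' : is_derive w 1 (fun w => (rt w)^-1) (- w / rt w ^+ 3).
  apply: (is_derive_eq (is_deriveV _ dr)); rewrite ?gt_eqF//.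
  by rewrite /GRing.scale/=; field; rewrite !gt_eqF.
suff : is_derive w 1 (Y n) (Y n.+1 w) /\ is_derive w 1 (Y n.+1) (Y n.+2 w).
  by case.
elim: n => [|n [IH1 IH2]].
  split.
    have := is_deriveD dp dp' => d; apply: (is_derive_eq d).
    by rewrite cosh_derivn1; field; rewrite !gt_eqF.
  have := is_deriveM (is_deriveZ beta (is_deriveB dp dp')) dr' => d.
  apply: (is_derive_eq d).
  rewrite cosh_derivnSS cosh_derivn0 cosh_derivn1 /GRing.scale/=.
  rewrite !fctE /GRing.scale/= expr0n/= double0.
  by field; rewrite !gt_eqF.
split=> //.
have dw : is_derive w 1 (fun w : R => w) 1 by exact: is_derive_id.
have d1 := is_deriveZ (beta ^+ 2 - n%:R ^+ 2) IH1.
have d2 := is_deriveM (is_deriveZ (n.*2.+1)%:R dw) IH2.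
have d := is_deriveM (is_deriveB d1 d2) (is_deriveM dr' dr').
have -> : Y n.+2 = (((beta ^+ 2 - n%:R ^+ 2) \*: Y n -
    ((n.*2.+1)%:R \*: (fun w : R => w)) * Y n.+1) *
    ((fun w => (rt w)^-1) * (fun w => (rt w)^-1))).
  apply/funext => x; rewrite cosh_derivnSS !fctE /GRing.scale/=.
  by rewrite -expr2 exprVn.
apply: (is_derive_eq d).
rewrite (cosh_derivnSS n.+1) !fctE /GRing.scale/= /GRing.scale/=.
have h : Y n.+2 w * rt w ^+ 2 =
    (beta ^+ 2 - n%:R ^+ 2) * Y n w - (n.*2.+1)%:R * w * Y n.+1 w.
  by rewrite cosh_derivnSS divfK// expf_neq0 ?gt_eqF.
(* The n-th term is eliminated in favour of the next two, which are the only ones in the recurrence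
   for order n + 3. *)
have -> : (beta ^+ 2 - n%:R ^+ 2) * Y n w =
    Y n.+2 w * rt w ^+ 2 + (n.*2.+1)%:R * w * Y n.+1 w by rewrite h; ring.
rewrite doubleS -addnn -!natr1 natrD.
by field; rewrite !gt_eqF.
Qed.

(** Each use of the recurrence divides by w^2 - 4, which the two extra powers of the square root
    absorb. The second limit supplies the vanishing initial value at w = 2 in the sign argument. *)
Lemma cosh_derivn_sqrt_cvg0 n :
  rt w ^+ (n.*2.+1) * Y n w @[w --> 2^'+] --> (0 : R) /\
  rt w ^+ (n.*2.+1) * Y n.+1 w @[w --> 2^'+] --> (0 : R).
Proof.
have rt2 : rt 2 = 0 by rewrite /joukowski_sqrt (_ : 2 ^+ 2 - 4 = 0) ?sqrtr0//; ring.
have vv2 : vv 2 = 1 by rewrite /joukowski_inv rt2; field.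
have crt : rt w @[w --> 2^'+] --> (0 : R).
  by apply: cvg_at_right_filter; rewrite -rt2; exact: continuous_joukowski_sqrt.
have cp : vv w `^ beta @[w --> 2^'+] --> (1 : R).
  apply: cvg_at_right_filter.
  have := @is_derive1_powR R beta 1 ltr01 => -[d _].
  have : {for vv 2, continuous (fun x : R => x `^ beta)}.
    by rewrite vv2; apply/differentiable_continuous/derivable1_diffP.
  move=> c; have := continuous_comp (@continuous_joukowski_inv R 2) c.
  move=> {}c; have e : vv 2 `^ beta = 1 by rewrite vv2 powR1.
  by rewrite -[X in _ --> X]e; exact: c.
have cp' : (vv w `^ beta)^-1 @[w --> 2^'+] --> (1 : R).
  by rewrite -[X in _ --> X]invr1; apply: cvgV => //; exact: oner_neq0.
elim: n => [|n [IH1 IH2]].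
  rewrite double0; split.
    rewrite -[X in _ --> X](mul0r (1 + 1 : R)).
    exact: (cvgM crt (cvgD cp cp')).
  have h : beta * (vv w `^ beta - (vv w `^ beta)^-1) @[w --> 2^'+] --> beta * (1 - 1).
    exact: (cvgMl_tmp (cvgB cp cp')).
  rewrite subrr mulr0 in h; apply: (near_cvg_eq _ h); near=> w => /=.
  have w2 : 2 < w by near: w; exact: nbhs_right_gt.
  have r0 := joukowski_sqrt_gt0 w2; have p0 := powR_gt0 beta (joukowski_inv_gt0 (ltW w2)).
  by rewrite cosh_derivn1 expr1; field; rewrite !gt_eqF.
have cw : w @[w --> 2^'+] --> (2 : R).
  by apply: cvg_at_right_filter; exact: cvg_id.
split.
  have h : rt w * rt w * (rt w ^+ (n.*2.+1) * Y n.+1 w) @[w --> 2^'+] --> (0 * 0 * 0 : R).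
    exact: cvgM (cvgM crt crt) IH2.
  rewrite !mul0r in h; apply: (near_cvg_eq _ h); near=> w => /=.
  by rewrite doubleS !exprS; ring.
have h : (beta ^+ 2 - n%:R ^+ 2) * (rt w ^+ (n.*2.+1) * Y n w) -
    (n.*2.+1)%:R * (w * (rt w ^+ (n.*2.+1) * Y n.+1 w)) @[w --> 2^'+] -->
    (beta ^+ 2 - n%:R ^+ 2) * 0 - (n.*2.+1)%:R * (2 * 0).
  exact: cvgB (cvgMl_tmp IH1) (cvgMl_tmp (cvgM cw IH2)).
rewrite !mulr0 subr0 in h.
apply: (near_cvg_eq _ h); near=> w => /=.
have w2 : 2 < w by near: w; exact: nbhs_right_gt.
have r0 := joukowski_sqrt_gt0 w2.
by rewrite cosh_derivnSS doubleS !exprS; field; rewrite !gt_eqF.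
Unshelve. all: by end_near. Qed.

Lemma nondecreasing_cvg0_ge0 (f f' : R -> R) (a : R) :
  (forall x, a < x -> is_derive x 1 f (f' x)) -> (forall x, a < x -> 0 <= f' x) ->
  f x @[x --> a^'+] --> (0 : R) -> forall x, a < x -> 0 <= f x.
Proof.
move=> df f'0 f0 x ax; apply: (cvgr_to_le f0); near=> y.
have ay : a < y by near: y; exact: nbhs_right_gt.
have yx : y < x by near: y; exact: nbhs_right_lt.
apply: (@ger0_derive1_le_cc _ f y x); rewrite ?in_itv/= ?lexx ?ltW//.
- by move=> z; rewrite in_itv/= => /andP[/(lt_trans ay)/df dz _].
- move=> z; rewrite in_itv/= => /andP[/(lt_trans ay) az _].
  by rewrite derive1E; have dz := df z az; rewrite derive_val f'0.
- apply: derivable_within_continuous => z; rewrite in_itv/= => /andP[yz _].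
  by have /df := lt_le_trans ay yz.
Unshelve. all: by end_near. Qed.

Hypotheses (beta0 : 0 < beta) (beta1 : beta <= 1).

(** With r = sqrt(w^2 - 4), the recurrence says that the derivative of r^(2n+3) y^(n+2) is r^(2n+1)
    (beta^2 - (n+1)^2) y^(n+1). Since beta <= 1 the coefficient is nonpositive, and the left-hand
    quantity starts from 0 at w = 2, so the sign alternates from one order to the next. *)
Lemma cosh_derivn_sign n w : 2 < w -> 0 <= (-1) ^+ n * Y n.+1 w.
Proof.
elim: n w => [|n IH] w w2.
  rewrite expr0 mul1r cosh_derivn1 divr_ge0 ?sqrtr_ge0// mulr_ge0 ?(ltW beta0)//.
  have v1 : 1 <= vv w.
    rewrite /joukowski_inv ler_pdivlMr// mul1r.
    by have := joukowski_sqrt_gt0 w2; lra.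
  have p1 : 1 <= vv w `^ beta.
    by rewrite -(powRr0 (vv w)) ler_powR// ltW.
  by rewrite subr_ge0 (le_trans _ p1)// invf_le1// (lt_le_trans ltr01 p1).
have : 0 <= (-1) ^+ n.+1 * (rt w ^+ (n.+1.*2.+1) * Y n.+2 w).
  pose f' w := (-1) ^+ n.+1 *
    (rt w ^+ (n.*2.+1) * (beta ^+ 2 - n.+1%:R ^+ 2) * Y n.+1 w).
  apply: (@nondecreasing_cvg0_ge0
    (fun w => (-1) ^+ n.+1 * (rt w ^+ (n.+1.*2.+1) * Y n.+2 w)) f' 2) w2 => {w}.
  - move=> w w2; have r0 := joukowski_sqrt_gt0 w2.
    have dr := is_derive_joukowski_sqrt w2.
    have dY := is_derive_cosh_derivn n.+2 w2.
    have d := is_deriveZ ((-1) ^+ n.+1) (is_deriveM (is_deriveX n.+1.*2.+1 dr) dY).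
    rewrite [X in is_derive _ _ X _](_ : _ = ((-1) ^+ n.+1 \*:
      (rt ^+ n.+1.*2.+1 * Y n.+2))); last first.
      by apply/funext => x; rewrite !fctE.
    apply: (is_derive_eq d).
    rewrite /f' (cosh_derivnSS n.+1) /GRing.scale/= /GRing.scale/= !fctE doubleS !exprS.
    field; rewrite gt_eqF//.
  - move=> w w2; have := IH w w2; have r0 := joukowski_sqrt_gt0 w2.
    have b1 : beta ^+ 2 - n.+1%:R ^+ 2 <= 0.
      rewrite subr_le0 ler_pXn2r ?nnegrE ?(ltW beta0)//.
      by rewrite (le_trans beta1)// ler1n.
    move=> h; have -> : f' w = (rt w ^+ n.*2.+1) * - (beta ^+ 2 - n.+1%:R ^+ 2) *
        ((-1) ^+ n * Y n.+1 w) by rewrite /f' exprS; ring.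
    by rewrite mulr_ge0// mulr_ge0 ?oppr_ge0// exprn_ge0// ltW.
  - rewrite -[X in _ --> X](mulr0 ((-1) ^+ n.+1)).
    exact: (cvgMl_tmp (cosh_derivn_sqrt_cvg0 n.+1).2).
by rewrite mulrCA pmulr_rge0// exprn_gt0// joukowski_sqrt_gt0.
Qed.

Lemma cm_upto_cosh_derivn1 n : cm_upto 2 n (Y 1).
Proof.
suff main m : cm_upto 2 n (fun w => (-1) ^+ m * Y m.+1 w).
  have := main 0%N; congr cm_upto; apply/funext => w; exact: mul1r.
elim: n m => [|n IH] m; split=> //; try exact: cosh_derivn_sign.
exists (fun w => (-1) ^+ m.+1 * Y m.+2 w) => // w w2.
have d := is_deriveZ ((-1) ^+ m) (is_derive_cosh_derivn m.+1 w2).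
by apply: (is_derive_eq d); rewrite /GRing.scale/= exprS; ring.
Qed.

End chebyshev_derivatives.

(** * The density for alpha <= 1/2 *)

Section ratio_density.
Context (R : realType).
Implicit Types (alpha x u v w : R).

Definition stable_ratio_denom alpha t : R := t ^+ 2 + 2 * cos (pi * alpha) * t + 1.

(** This is |t + e^(i pi alpha)|^2. *)
Definition stable_ratio_density alpha x : R :=
  sin (pi * alpha) / pi * x `^ (alpha - 1) / stable_ratio_denom alpha (x `^ alpha).

Lemma sin_pi_gt0 alpha : 0 < alpha -> alpha < 1 -> 0 < sin (pi * alpha) :> R.
Proof.
move=> a0 a1; have p0 := pi_gt0 R.
by apply: sin_gt0_pi; rewrite mulr_gt0//= -[ltRHS]mulr1 ltr_pM2l.
Qed.

Lemma stable_ratio_denom_gt0 alpha t : 0 < alpha -> alpha < 1 ->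
  0 < stable_ratio_denom alpha t.
Proof.
move=> a0 a1; have s0 := sin_pi_gt0 a0 a1.
have -> : stable_ratio_denom alpha t =
    (t + cos (pi * alpha)) ^+ 2 + sin (pi * alpha) ^+ 2.
  by rewrite sin2cos2 /stable_ratio_denom; ring.
by rewrite ltr_wpDl ?sqr_ge0// exprn_gt0.
Qed.

Lemma stable_ratio_density_gt0 alpha x : 0 < alpha -> alpha < 1 -> 0 < x ->
  0 < stable_ratio_density alpha x.
Proof.
move=> a0 a1 x0; rewrite divr_gt0 ?stable_ratio_denom_gt0//.
by rewrite mulr_gt0 ?powR_gt0// divr_gt0 ?pi_gt0// sin_pi_gt0.
Qed.

Lemma hcm_stable_ratio_density alpha : 0 < alpha -> alpha <= 1 / 2 ->
  hcm_function (stable_ratio_density alpha).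
Proof.
move=> a0 a12; have a1 : alpha < 1 by lra.
split=> [x x0|u u0]; first exact: stable_ratio_density_gt0.
have c0 : 0 <= cos (pi * alpha) :> R.
  have p0 := pi_gt0 R.
  by apply: cos_ge0_pihalf; apply/andP; split; nra.
set c := cos (pi * alpha) in c0.
pose U := u `^ alpha; have U0 : 0 < U by exact: powR_gt0.
(* In f(uv) f(u/v) the powers v^(alpha-1) and v^(1-alpha) cancel, so [K] is free of v. With V =
   v^alpha, [D] below is the product of the two denominators, at U V and U / V, expanded in V + 1/V
   and V^2 + 1/V^2. *)
pose K := (sin (pi * alpha) / pi * u `^ (alpha - 1)) ^+ 2.
pose D w := (U ^+ 4 + 1 + 4 * c ^+ 2 * U ^+ 2) +
  (2 * c * (U ^+ 3 + U) * cosh_derivn alpha 0 w +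
   U ^+ 2 * cosh_derivn (2 * alpha) 0 w).
have Y0 beta w : 2 <= w -> 0 < cosh_derivn beta 0 w.
  move=> w2; have p0 := powR_gt0 beta (joukowski_inv_gt0 w2).
  by rewrite cosh_derivn0 addr_gt0 ?invr_gt0.
have D0 w : 2 <= w -> 0 < D w.
  move=> w2; have := Y0 alpha w w2; have := Y0 (2 * alpha) w w2 => Y1 Y2.
  apply: addr_gt0; last apply: ltr_wpDl.
  - by rewrite -addrA ltr_wpDr ?exprn_gt0// addr_ge0// mulr_ge0 ?sqr_ge0// mulr_ge0 ?sqr_ge0.
  - by rewrite mulr_ge0 ?(ltW Y2)// mulr_ge0 ?mulr_ge0// addr_ge0 ?exprn_ge0// ltW.
  - by rewrite mulr_gt0// exprn_gt0.
exists (fun w => K * (D w)^-1); split.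
  move=> v v0; have uv0 : 0 < u * v by rewrite mulr_gt0.
  have v'0 : 0 < v^-1 by rewrite invr_gt0.
  have P0 : 0 < v `^ alpha by exact: powR_gt0.
  have vV b : v^-1 `^ b = (v `^ b)^-1.
    by rewrite -(powR_inv1 (ltW v0)) -powRrM mulN1r powRN.
  have Yv beta : cosh_derivn beta 0 (v + v^-1) = v `^ beta + (v `^ beta)^-1.
    rewrite cosh_derivn0; case: (joukowski_invK v0) => -> //.
    by rewrite vV invrK addrC.
  have sq : v `^ (2 * alpha) = (v `^ alpha) ^+ 2.
    by rewrite mulrC powRrM -[2]/(2%:R) powR_mulrn// powR_ge0.
  have N1 := stable_ratio_denom_gt0 (U * v `^ alpha) a0 a1.
  have N2 := stable_ratio_denom_gt0 (U / v `^ alpha) a0 a1.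
  rewrite /D !Yv sq /stable_ratio_density !powRM ?ltW// !vV -/U.
  have -> : U ^+ 4 + 1 + 4 * c ^+ 2 * U ^+ 2 +
    (2 * c * (U ^+ 3 + U) * (v `^ alpha + (v `^ alpha)^-1) +
     U ^+ 2 * ((v `^ alpha) ^+ 2 + ((v `^ alpha) ^+ 2)^-1)) =
    stable_ratio_denom alpha (U * v `^ alpha) *
    stable_ratio_denom alpha (U / v `^ alpha).
    by rewrite /stable_ratio_denom -/c; field; rewrite gt_eqF.
  have V0 : 0 < v `^ (alpha - 1) by exact: powR_gt0.
  by rewrite /K; set k := _ / pi; field; rewrite !gt_eqF.
have dD w : 2 < w -> is_derive w 1 D
    (2 * c * (U ^+ 3 + U) * cosh_derivn alpha 1 w +
     U ^+ 2 * cosh_derivn (2 * alpha) 1 w).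
  move=> w2; have d1 := is_derive_cosh_derivn alpha 0 w2.
  have d2 := is_derive_cosh_derivn (2 * alpha) 0 w2.
  have d := is_deriveD (is_derive_cst (U ^+ 4 + 1 + 4 * c ^+ 2 * U ^+ 2) w 1)
    (is_deriveD (is_deriveZ (2 * c * (U ^+ 3 + U)) d1)
                (is_deriveZ (U ^+ 2) d2)).
  by apply: (is_derive_eq d); rewrite add0r.
split.
  apply: continuous_in_subspaceT => w; rewrite inE/= in_itv/= andbT => w2.
  have cY beta : {for w, continuous (cosh_derivn beta 0)}.
    have p0 := powR_gt0 beta (joukowski_inv_gt0 w2).
    have cp : {for w, continuous (fun w => joukowski_inv w `^ beta)}.
      apply: (@continuous_comp _ _ _ (@joukowski_inv R) (fun x => x `^ beta)).
        exact: continuous_joukowski_inv.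
      apply/differentiable_continuous/derivable1_diffP.
      by apply: derivable_powR; rewrite in_itv/= joukowski_inv_gt0.
    apply: cvgD; first exact: cp.
    by apply: cvgV => //; rewrite gt_eqF.
  apply: cvgMl_tmp; apply: cvgV; first by rewrite gt_eqF// D0.
  apply: cvgD; first exact: cvg_cst.
  by apply: cvgD; apply: cvgMl_tmp; exact: cY.
move=> n w w2; apply: cm_upto_derive1n w2.
apply: cm_uptoM; first by apply: cm_upto_cst; exact: sqr_ge0.
apply: cm_upto_inv dD _ _ => [x x2|m]; first exact/D0/ltW.
have U30 : 0 <= U ^+ 3 + U by rewrite addr_ge0 ?exprn_ge0// ltW.
apply: cm_uptoD; (apply: cm_uptoM; first apply: cm_upto_cst).
- by rewrite mulr_ge0// mulr_ge0.
- by apply: cm_upto_cosh_derivn1 => //; lra.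
- by rewrite sqr_ge0.
- by apply: cm_upto_cosh_derivn1 => //; lra.
Qed.

End ratio_density.

(** * The Stieltjes transform of the density *)

Section improper_ftc.
Context (R : realType).
Local Notation mu := (@lebesgue_measure R).

(** The interval is cut at [s], where [F] is only known to be continuous; continuity makes the two
    boundary values at [s] cancel. The point [s] will correspond to y = 0, the abscissa of the
    removable singularity. *)
Lemma continuous_FTC2_except (f F : R -> R) (s a b : R) : 0 < a -> a < b ->
  (forall x, 0 < x -> 0 <= f x) ->
  (forall x, 0 < x -> {for x, continuous f}) ->
  (forall x, 0 < x -> {for x, continuous F}) ->
  (forall x, 0 < x -> x != s -> is_derive x 1 F (f x)) ->
  (\int[mu]_(x in `[a, b]) (f x)%:E = (F b - F a)%:E)%E.
Proof.
move=> a0 ab f0 cf cF dF.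
have base x y : 0 < x -> x < y -> (forall z, x < z < y -> z != s) ->
    (\int[mu]_(x in `[x, y]) (f x)%:E = (F y - F x)%:E)%E.
  move=> x0 xy sxy; rewrite EFinB; apply: continuous_FTC2 => //.
  - apply: continuous_in_subspaceT => z; rewrite inE/= in_itv/= => /andP[xz _].
    exact/cf/(lt_le_trans x0).
  - split.
    + move=> z; rewrite in_itv/= => zxy; have /andP[xz _] := zxy.
      by have := dF z (lt_trans x0 xz) (sxy z zxy) => -[].
    + by apply: cvg_at_right_filter; exact: cF.
    + by apply: cvg_at_left_filter; apply: cF; exact: lt_trans xy.
  - move=> z; rewrite in_itv/= => zxy; have /andP[xz _] := zxy.
    rewrite derive1E.
    by have dz := dF z (lt_trans x0 xz) (sxy z zxy); rewrite derive_val.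
have [/andP[as_ sb]|nsab] := boolP (a < s < b); last first.
  by apply: base => // z zab; apply/eqP => zs; move: nsab; rewrite -zs zab.
have mf (c d : R) : 0 < c -> measurable_fun `[c, d] (fun x => (f x)%:E).
  move=> c0; apply/measurable_EFinP; apply: subspace_continuous_measurable_fun => //.
  apply: continuous_in_subspaceT => z; rewrite inE/= in_itv/= => /andP[xz _].
  exact/cf/(lt_le_trans c0).
have s0 := lt_trans a0 as_.
have -> : `[a, b]%classic = `[a, s]%classic `|` `]s, b]%classic.
  by rewrite -itv_bndbnd_setU// bnd_simp ltW.
rewrite ge0_integral_setU//=.
- rewrite base//; last by move=> z /andP[_ zs]; rewrite lt_eqF.
  rewrite integral_itv_obnd_cbnd; last first.
    by apply: measurable_funS (mf s b s0) => //; exact: subset_itv_oc_cc.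
  rewrite base//; last by move=> z /andP[zs _]; rewrite gt_eqF.
  by rewrite -EFinD; congr EFin; ring.
- by rewrite -itv_bndbnd_setU ?bnd_simp ?ltW//; exact: mf.
- move=> x [] /=; rewrite in_itv/= lee_fin => /andP[ax _]; apply: f0.
    exact: lt_le_trans ax.
  exact: lt_trans ax.
- apply/disj_setPS => x [/=]; rewrite !in_itv/= => /andP[_ xs] /andP[sx _].
  by move: sx; rewrite ltNge xs.
Qed.

Lemma ge0_integral_0y (f F : R -> R) (s l0 l1 : R) :
  (forall x, 0 < x -> 0 <= f x) ->
  (forall x, 0 < x -> {for x, continuous f}) ->
  (forall x, 0 < x -> {for x, continuous F}) ->
  (forall x, 0 < x -> x != s -> is_derive x 1 F (f x)) ->
  F x @[x --> 0^'+] --> l0 -> F x @[x --> +oo] --> l1 ->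
  (\int[mu]_(x in `]0%R, +oo[) (f x)%:E = (l1 - l0)%:E)%E.
Proof.
move=> f0 cf cF dF F0 F1.
(* The shift by 2 makes the interval nondegenerate already for n = 0. *)
pose I (n : nat) := `[n.+2%:R^-1, n.+2%:R]%classic : set R.
have posn (n : nat) : 0 < n.+2%:R^-1 :> R by rewrite invr_gt0.
have -> : `]0%R, +oo[%classic = \bigcup_n I n.
  apply/seteqP; split => x /=; rewrite in_itv/= andbT.
    move=> x0.
    have [n nx] : exists n : nat, x <= n%:R.
      by exists (Num.truncn x).+1; rewrite ltW// truncnS_gt.
    have [m mx] : exists n : nat, x^-1 <= n%:R.
      by exists (Num.truncn x^-1).+1; rewrite ltW// truncnS_gt.
    exists (maxn n m) => //; rewrite /I/= in_itv/=; apply/andP; split.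
      rewrite -[leRHS]invrK lef_pV2 ?posrE ?invr_gt0//.
      by rewrite (le_trans mx)// ler_nat (leq_trans (leq_maxr n m))// -addn2 leq_addr.
    by rewrite (le_trans nx)// ler_nat (leq_trans (leq_maxl n m))// -addn2 leq_addr.
  by move=> [n _]; rewrite /I/= in_itv/= => /andP[nx _]; exact: lt_le_trans nx.
have cvg1 : (\int[mu]_(x in I i) (f x)%:E @[i --> \oo] -->
    \int[mu]_(x in \bigcup_i I i) (f x)%:E)%E.
  apply: ge0_nondecreasing_set_cvg_integral => //.
  - move=> m n mn; apply/subsetPset => x; rewrite /I/= !in_itv/= => /andP[mx xm].
    apply/andP; split.
      by rewrite (le_trans _ mx)// lef_pV2 ?posrE// ler_nat !ltnS.
    by rewrite (le_trans xm)// ler_nat !ltnS.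
  - move=> n; exact: measurable_itv.
  - move=> n; apply/measurable_EFinP; apply: subspace_continuous_measurable_fun => //.
      exact: measurable_itv.
    apply: continuous_in_subspaceT => z; rewrite /I inE/= in_itv/= => /andP[xz _].
    exact/cf/(lt_le_trans (posn n)).
  - move=> n x; rewrite /I/= in_itv/= => /andP[nx _]; rewrite lee_fin f0//.
    exact: lt_le_trans nx.
have cvg2 : ((F n.+2%:R - F n.+2%:R^-1)%:E @[n --> \oo] --> (l1 - l0)%:E)%E.
  apply: cvg_EFin; first exact: nearW.
  apply: cvgB.
    move/cvg_pinftyP : F1; apply.
    apply/cvgryPge => A; near=> n; have nA : A <= n%:R by near: n; exact: nbhs_infty_ger.
    by rewrite (le_trans nA)// ler_nat -addn2 leq_addr.
  move/cvg_at_rightP : F0; apply; split => [n|]; first exact: posn.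
  have := @cvg_harmonic R.
  by rewrite -(cvg_shiftn 1)/=; under eq_fun do rewrite addn1.
apply: (@cvg_unique _ (@ereal_hausdorff R) _ _ _ _ cvg1).
apply: (near_cvg_eq _ cvg2).
near=> n; rewrite (continuous_FTC2_except (s := s)) ?posn//.
  by apply: (@lt_trans _ _ 1); rewrite ?invf_lt1 ?ltr1n.
Unshelve. all: by end_near. Qed.

End improper_ftc.

(** * Complex arithmetic and Cauchy-Riemann equations on pairs of reals *)

Section complex_pairs.
Context (R : realType).
Implicit Types (z w p : R * R) (F G : R * R -> R * R).

Definition cmul z w : R * R := (z.1 * w.1 - z.2 * w.2, z.1 * w.2 + z.2 * w.1).
Definition csqn z : R := z.1 ^+ 2 + z.2 ^+ 2.
Definition cinv z : R * R := (z.1 / csqn z, - z.2 / csqn z).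
Definition cexp (l : R) p : R * R :=
  (expR (l * p.1) * cos (l * p.2), expR (l * p.1) * sin (l * p.2)).

Lemma csqn_ge0 z : 0 <= csqn z.
Proof. by rewrite addr_ge0 ?sqr_ge0. Qed.

Lemma csqnM z w : csqn (cmul z w) = csqn z * csqn w.
Proof. by rewrite /csqn/=; ring. Qed.

(** It extends to z = 0 by the convention 0^-1 = 0, so the modulus of the kernel factors with no
    side condition. *)
Lemma csqnV z : csqn (cinv z) = (csqn z)^-1.
Proof.
have [z0|z0] := eqVneq (csqn z) 0.
  by rewrite /cinv z0 invr0 !mulr0 /csqn/= expr0n addr0.
have : csqn (cinv z) = csqn z / csqn z ^+ 2.
  by rewrite {1}/csqn/= !exprMn !exprVn sqrrN -mulrDl.
by move=> ->; field.
Qed.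

Lemma sqr_re_le_csqn z : z.1 ^+ 2 <= csqn z.
Proof. by rewrite lerDl sqr_ge0. Qed.

(* [F] is holomorphic at [p] as a function of [p.1 + i p.2], with complex
   derivative [F']. *)
Definition holo_at F F' p : Prop :=
  [/\ is_derive p.1 1 (fun y => (F (y, p.2)).1) (F' p).1,
      is_derive p.1 1 (fun y => (F (y, p.2)).2) (F' p).2,
      is_derive p.2 1 (fun t => (F (p.1, t)).1) (- (F' p).2),
      is_derive p.2 1 (fun t => (F (p.1, t)).2) (F' p).1 &
      [/\ {for p, continuous (fun q => (F q).1)},
          {for p, continuous (fun q => (F q).2)},
          {for p, continuous (fun q => (F' q).1)} &
          {for p, continuous (fun q => (F' q).2)}]].

Lemma holo_at_exp l p : holo_at (cexp l) (fun q => (l * (cexp l q).1, l * (cexp l q).2)) p.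
Proof.
have dl (x : R) : is_derive x 1 (fun y => l * y) l.
  by apply: is_derive_eq; rewrite /GRing.scale/= mulr1.
have dexp (x : R) : is_derive x 1 (fun y => expR (l * y)) (l * expR (l * x)).
  have := @is_derive1_comp _ expR (fun y => l * y) x _ _ (is_derive_expR _) (dl x).
  by move=> d; apply: (is_derive_eq d); rewrite mulrC.
have dcos (x : R) : is_derive x 1 (fun y => cos (l * y)) (- (l * sin (l * x))).
  have := @is_derive1_comp _ cos (fun y => l * y) x _ _ (is_derive_cos _) (dl x).
  by move=> d; apply: (is_derive_eq d); ring.
have dsin (x : R) : is_derive x 1 (fun y => sin (l * y)) (l * cos (l * x)).
  have := @is_derive1_comp _ sin (fun y => l * y) x _ _ (is_derive_sin _) (dl x).
  by move=> d; apply: (is_derive_eq d); ring.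
have c1 : {for p, continuous (fun q : R * R => expR (l * q.1))}.
  apply: (@continuous_comp _ _ _ (fun q : R * R => l * q.1) expR).
    by apply: cvgMl_tmp; exact: cvg_fst.
  exact: continuous_expR.
have c2 : {for p, continuous (fun q : R * R => cos (l * q.2))}.
  apply: (@continuous_comp _ _ _ (fun q : R * R => l * q.2) cos).
    by apply: cvgMl_tmp; exact: cvg_snd.
  exact: continuous_cos.
have c3 : {for p, continuous (fun q : R * R => sin (l * q.2))}.
  apply: (@continuous_comp _ _ _ (fun q : R * R => l * q.2) sin).
    by apply: cvgMl_tmp; exact: cvg_snd.
  exact: continuous_sin.
have ca : {for p, continuous (fun q => (cexp l q).1)} by exact: cvgM c1 c2.
have cb : {for p, continuous (fun q => (cexp l q).2)} by exact: cvgM c1 c3.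
split => /=.
- apply: (is_derive_eq (is_deriveM (dexp p.1) (is_derive_cst (cos (l * p.2)) p.1 1))).
  by rewrite /GRing.scale/=; ring.
- apply: (is_derive_eq (is_deriveM (dexp p.1) (is_derive_cst (sin (l * p.2)) p.1 1))).
  by rewrite /GRing.scale/=; ring.
- apply: (is_derive_eq (is_deriveZ (expR (l * p.1)) (dcos p.2))).
  by rewrite /GRing.scale/=; ring.
- apply: (is_derive_eq (is_deriveZ (expR (l * p.1)) (dsin p.2))).
  by rewrite /GRing.scale/=; ring.
- by split; [exact: ca|exact: cb|exact: cvgMl_tmp ca|exact: cvgMl_tmp cb].
Qed.

Lemma holo_at_affine (k m : R) F F' p : holo_at F F' p ->
  holo_at (fun q => (k + m * (F q).1, m * (F q).2))
          (fun q => (m * (F' q).1, m * (F' q).2)) p.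
Proof.
case=> d1 d2 d3 d4 [c1 c2 c3 c4]; split => /=.
- by apply: (is_derive_eq (is_deriveD (is_derive_cst k p.1 1) (is_deriveZ m d1))); rewrite add0r.
- exact: (is_deriveZ m d2).
- apply: (is_derive_eq (is_deriveD (is_derive_cst k p.2 1) (is_deriveZ m d3))).
  by rewrite add0r /GRing.scale/= mulrN.
- exact: (is_deriveZ m d4).
- split; [|exact: cvgMl_tmp c2|exact: cvgMl_tmp c3|exact: cvgMl_tmp c4].
  exact: cvgD (cvg_cst _) (cvgMl_tmp c1).
Qed.

Lemma holo_at_mul F F' G G' p : holo_at F F' p -> holo_at G G' p ->
  holo_at (fun q => cmul (F q) (G q))
    (fun q => ((cmul (F' q) (G q)).1 + (cmul (F q) (G' q)).1,
               (cmul (F' q) (G q)).2 + (cmul (F q) (G' q)).2)) p.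
Proof.
case: p => y t.
case=> /= d1 d2 d3 d4 [c1 c2 c3 c4] [/= e1 e2 e3 e4 [b1 b2 b3 b4]]; split => /=.
- apply: (is_derive_eq (is_deriveB (is_deriveM d1 e1) (is_deriveM d2 e2))).
  by rewrite /GRing.scale/=; ring.
- apply: (is_derive_eq (is_deriveD (is_deriveM d1 e2) (is_deriveM d2 e1))).
  by rewrite /GRing.scale/=; ring.
- apply: (is_derive_eq (is_deriveB (is_deriveM d3 e3) (is_deriveM d4 e4))).
  by rewrite /GRing.scale/=; ring.
- apply: (is_derive_eq (is_deriveD (is_deriveM d3 e4) (is_deriveM d4 e3))).
  by rewrite /GRing.scale/=; ring.
- split.
  + exact: cvgB (cvgM c1 b1) (cvgM c2 b2).
  + exact: cvgD (cvgM c1 b2) (cvgM c2 b1).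
  + exact: cvgD (cvgB (cvgM c3 b1) (cvgM c4 b2)) (cvgB (cvgM c1 b3) (cvgM c2 b4)).
  + exact: cvgD (cvgD (cvgM c3 b2) (cvgM c4 b1)) (cvgD (cvgM c1 b4) (cvgM c2 b3)).
Qed.

Lemma holo_at_inv F F' p : csqn (F p) != 0 -> holo_at F F' p ->
  holo_at (fun q => cinv (F q))
    (fun q => (- (cmul (F' q) (cmul (cinv (F q)) (cinv (F q)))).1,
               - (cmul (F' q) (cmul (cinv (F q)) (cinv (F q)))).2)) p.
Proof.
case: p => y t N0.
case=> /= d1 d2 d3 d4 [c1 c2 c3 c4].
have dsq (x : R) (f g : R -> R) (f' g' : R) : is_derive x 1 f f' -> is_derive x 1 g g' ->
    is_derive x 1 (fun y => csqn (f y, g y)) (2 * (f x * f' + g x * g')).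
  move=> df dg; have -> : (fun y => csqn (f y, g y)) = f * f + g * g.
    by apply/funext => z; rewrite /csqn/= !expr2.
  apply: (is_derive_eq (is_deriveD (is_deriveM df df) (is_deriveM dg dg))).
  by rewrite /GRing.scale/=; ring.
have e q : ((F q).1, (F q).2) = F q by case: (F q).
have dN1 : is_derive y 1 (fun y => (csqn (F (y, t)))^-1)
    (- (csqn (F (y, t))) ^- 2 *:
     (2 * ((F (y, t)).1 * (F' (y, t)).1 + (F (y, t)).2 * (F' (y, t)).2))).
  apply: (@is_deriveV _ (fun y => csqn (F (y, t)))) => //.
  by have := dsq _ _ _ _ _ d1 d2; under eq_fun do rewrite e.
have dN2 : is_derive t 1 (fun t => (csqn (F (y, t)))^-1)
    (- (csqn (F (y, t))) ^- 2 *: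
     (2 * ((F (y, t)).1 * - (F' (y, t)).2 + (F (y, t)).2 * (F' (y, t)).1))).
  apply: (@is_deriveV _ (fun t => csqn (F (y, t)))) => //.
  by have := dsq _ _ _ _ _ d3 d4; under eq_fun do rewrite e.
have cN : {for (y, t), continuous (fun q => (csqn (F q))^-1)}.
  by apply: cvgV => //; exact: cvgD (cvgM c1 c1) (cvgM c2 c2).
have ci1 : {for (y, t), continuous (fun q => (cinv (F q)).1)} by exact: cvgM c1 cN.
have ci2 : {for (y, t), continuous (fun q => (cinv (F q)).2)}.
  by apply: cvgM cN; exact: cvgN c2.
have cii1 : {for (y, t), continuous (fun q => (cmul (cinv (F q)) (cinv (F q))).1)}.
  exact: cvgB (cvgM ci1 ci1) (cvgM ci2 ci2).
have cii2 : {for (y, t), continuous (fun q => (cmul (cinv (F q)) (cinv (F q))).2)}.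
  exact: cvgD (cvgM ci1 ci2) (cvgM ci2 ci1).
have N0' : (F (y, t)).1 ^+ 2 + (F (y, t)).2 ^+ 2 != 0 by exact: N0.
split => /=.
- apply: (is_derive_eq (is_deriveM d1 dN1)).
  by rewrite /GRing.scale/= /csqn ?fctE; field.
- apply: (is_derive_eq (is_deriveM (is_deriveN d2) dN1)).
  by rewrite /GRing.scale/= /csqn ?fctE; field.
- apply: (is_derive_eq (is_deriveM d3 dN2)).
  by rewrite /GRing.scale/= /csqn ?fctE; field.
- apply: (is_derive_eq (is_deriveM (is_deriveN d4) dN2)).
  by rewrite /GRing.scale/= /csqn ?fctE; field.
- split => //.
  + by apply: cvgN; exact: cvgB (cvgM c3 cii1) (cvgM c4 cii2).
  + by apply: cvgN; exact: cvgD (cvgM c3 cii2) (cvgM c4 cii1).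
Qed.

End complex_pairs.

(** * The kernel on the strip: holomorphy and bounds *)

Section keyhole_kernel.
Context (R : realType) (alpha c : R).
Hypotheses (alpha0 : 0 < alpha) (alpha1 : alpha < 1) (c0 : 0 < c).
Local Notation mu := (@lebesgue_measure R).
Implicit Types (p : R * R) (y t : R).

Definition caffine (k m : R) (z : R * R) : R * R := (k + m * z.1, m * z.2).

Definition keyhole_num p := caffine (-1) 1 (cexp alpha p).
Definition keyhole_den p := caffine 1 c (cexp alpha p).
Definition keyhole_pole p := caffine 1 (-1) (cexp (-1) p).

(* With [z = y + i t] this is [(e^(alpha z) - 1) / ((1 + c e^(alpha z)) (1 - e^(-z)))],
   whose singularity at [z = 0] is removable. *)
Definition keyhole p : R * R :=
  cmul (cmul (keyhole_num p) (cinv (keyhole_den p))) (cinv (keyhole_pole p)).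

Lemma csqn_caffine_cexp (k m l y t : R) : csqn (caffine k m (cexp l (y, t))) =
  k ^+ 2 + 2 * k * m * expR (l * y) * cos (l * t) + (m * expR (l * y)) ^+ 2.
Proof.
rewrite /csqn /caffine /cexp/= !exprMn.
by rewrite sin2cos2; ring.
Qed.

Lemma alpha_mul_in t : 0 <= t <= pi -> alpha * t \in `[0, pi].
Proof.
move=> /andP[t0 tp]; rewrite in_itv/= mulr_ge0 ?(ltW alpha0)//=.
by rewrite (le_trans _ tp)// ler_piMl// ltW.
Qed.

Lemma cos_alpha_ge t : 0 <= t <= pi -> cos (pi * alpha) <= cos (alpha * t).
Proof.
move=> t01; have /andP[_ tp] := t01; rewrite [pi * _]mulrC leNgt.
rewrite ltr_cos ?alpha_mul_in//; last by rewrite lexx pi_ge0.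
by rewrite -leNgt ler_pM2l.
Qed.

Lemma sin_alpha_gt0 : 0 < sin (pi * alpha).
Proof.
by apply: sin_gt0_pi; rewrite mulr_gt0 ?pi_gt0//= -[ltRHS]mulr1 ltr_pM2l ?pi_gt0.
Qed.

(** With r = c e^(alpha y), the angle alpha t lies in [0, pi alpha], so |1 + r e^(i alpha t)|^2 is
    at least r^2 + 2 r cos(pi alpha) + 1 = (r + cos(pi alpha))^2 + sin(pi alpha)^2. The denominator
    thus stays away from zero on the whole closed strip. *)
Lemma csqn_keyhole_den y t : 0 <= t <= pi ->
  sin (pi * alpha) ^+ 2 <= csqn (keyhole_den (y, t)).
Proof.
move=> t01; have h := cos_alpha_ge t01.
rewrite csqn_caffine_cexp sin2cos2.
have E0 : 0 < c * expR (alpha * y) by rewrite mulr_gt0 ?expR_gt0.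
have h' : c * expR (alpha * y) * cos (pi * alpha) <= c * expR (alpha * y) * cos (alpha * t).
  by rewrite ler_pM2l.
have := sqr_ge0 (c * expR (alpha * y) + cos (pi * alpha)).
rewrite (_ : (_ + _) ^+ 2 = (c * expR (alpha * y)) ^+ 2 +
  2 * (c * expR (alpha * y) * cos (pi * alpha)) + cos (pi * alpha) ^+ 2); last by ring.
rewrite (_ : 2 * 1 * c * _ * _ = 2 * (c * expR (alpha * y) * cos (alpha * t))); last by ring.
by lra.
Qed.

Lemma csqn_keyhole_pole_eq y t : csqn (keyhole_pole (y, t)) =
  (1 - expR (- y)) ^+ 2 + 2 * expR (- y) * (1 - cos t).
Proof. by rewrite csqn_caffine_cexp !mulN1r cosN; ring. Qed.

Lemma csqn_keyhole_pole y t :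
  (1 - expR (- y)) ^+ 2 <= csqn (keyhole_pole (y, t)).
Proof.
by rewrite csqn_keyhole_pole_eq lerDl mulr_ge0 ?mulr_ge0 ?expR_ge0// subr_ge0 cos_le1.
Qed.

Lemma csqn_keyhole_num_eq y t : csqn (keyhole_num (y, t)) =
  (expR (alpha * y) - 1) ^+ 2 + 2 * expR (alpha * y) * (1 - cos (alpha * t)).
Proof. by rewrite csqn_caffine_cexp; ring. Qed.

Lemma csqn_keyhole_pole_gt0 y t : (y != 0) || (0 < t <= pi) ->
  0 < csqn (keyhole_pole (y, t)).
Proof.
move=> /orP[y0|/andP[t0 tp]].
  apply: lt_le_trans (csqn_keyhole_pole y t).
  by rewrite exprn_even_gt0//= subr_eq0 eq_sym -expR0 (inj_eq (@expR_inj R)) oppr_eq0.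
rewrite csqn_keyhole_pole_eq ltr_wpDl ?sqr_ge0// mulr_gt0 ?mulr_gt0 ?expR_gt0//.
by rewrite subr_gt0 -[ltRHS]cos0 ltr_cos// in_itv/= ?lexx ?pi_ge0// (ltW t0).
Qed.

Lemma csqn_keyhole p : csqn (keyhole p) =
  csqn (keyhole_num p) / csqn (keyhole_den p) / csqn (keyhole_pole p).
Proof. by rewrite /keyhole !csqnM !csqnV. Qed.

Lemma holo_keyhole : exists G, forall y t, 0 <= t <= pi ->
  (y != 0) || (0 < t <= pi) -> holo_at keyhole G (y, t).
Proof.
(* The complex derivative is never written out: unification assembles it from the closure rules. *)
eexists => y t t01 yt; apply: holo_at_mul; first apply: holo_at_mul.
- by apply: holo_at_affine; exact: holo_at_exp.
- apply: holo_at_inv; last by apply: holo_at_affine; exact: holo_at_exp.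
  by rewrite gt_eqF// (lt_le_trans _ (csqn_keyhole_den y t01))// exprn_gt0// sin_alpha_gt0.
- apply: holo_at_inv; last by apply: holo_at_affine; exact: holo_at_exp.
  by rewrite gt_eqF// csqn_keyhole_pole_gt0.
Qed.

(** For y >= 0, e^(alpha y) - 1 <= e^y - 1 = e^y (1 - e^(-y)); for y < 0 the same chain holds with
    both signs reversed. On |y| <= 1 the factor e^y is at most e. *)
Lemma expR_alphaB1_le y : `|y| <= 1 ->
  (expR (alpha * y) - 1) ^+ 2 <= expR 1 ^+ 2 * (1 - expR (- y)) ^+ 2.
Proof.
move=> y1; rewrite -exprMn -[leLHS]real_normK ?num_real// -[leRHS]real_normK ?num_real//.
rewrite ler_pXn2r ?nnegrE// normrM (gtr0_norm (expR_gt0 1)).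
have [y0|y0] := leP 0 y.
- have h : 1 <= expR (alpha * y) by rewrite -expR0 ler_expR mulr_ge0// ltW.
  have h' : expR (- y) <= 1 by rewrite -expR0 ler_expR oppr_le0.
  rewrite !ger0_norm ?subr_ge0//.
  have e1 : expR (alpha * y) <= expR y by rewrite ler_expR ler_piMl// ltW.
  have e2 : expR y <= expR 1 by rewrite ler_expR; move: y1; rewrite ger0_norm.
  have e3 := expRxMexpNx_1 y.
  have e4 : expR y * (1 - expR (- y)) <= expR 1 * (1 - expR (- y)).
    by rewrite ler_wpM2r// subr_ge0.
  by move: e4; rewrite mulrBr e3 mulr1 => /(le_trans _); apply; rewrite lerD2r.
- have h : expR (alpha * y) <= 1 by rewrite -expR0 ler_expR pmulr_rle0// ltW.
  have h' : 1 <= expR (- y) by rewrite -expR0 ler_expR oppr_ge0 ltW.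
  rewrite !ler0_norm ?subr_le0// !opprB.
  have e1 : expR y <= expR (alpha * y) by rewrite ler_expR ler_niMl// ltW.
  have e2 : 1 <= expR 1 :> R by rewrite -expR0 ler_expR.
  have e3 := expRxMexpNx_1 y.
  have e4 : expR y <= 1 by rewrite -expR0 ler_expR ltW.
  have e5 : expR y * (expR (- y) - 1) <= expR 1 * (expR (- y) - 1).
    by rewrite ler_wpM2r ?subr_ge0// (le_trans e4).
  by move: e5; rewrite mulrBr e3 mulr1 => /(le_trans _); apply; rewrite lerB.
Qed.

(** The singularity at 0 is removed quantitatively. The squared moduli of numerator and pole are
    each the square of a real difference plus a multiple of 1 - cos, and each of the two terms of
    the numerator is at most e^2 times its counterpart. *)
Lemma keyhole_bounded y t : `|y| <= 1 -> 0 <= t <= pi ->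
  csqn (keyhole (y, t)) <= expR 1 ^+ 2 / sin (pi * alpha) ^+ 2.
Proof.
move=> y1 t01; have /andP[t0 tp] := t01.
have s0 : 0 < sin (pi * alpha) ^+ 2 by rewrite exprn_gt0// sin_alpha_gt0.
have D1 := csqn_keyhole_den y t01; have D0 := lt_le_trans s0 D1.
rewrite csqn_keyhole -mulrA [_^-1 * _]mulrC mulrA.
apply: ler_pM; rewrite ?invr_ge0 ?divr_ge0 ?csqn_ge0//; last by rewrite lef_pV2.
(* This happens only at y = t = 0, where the inverse is 0 by convention and the bound is trivial. *)
have [P0|P0] := eqVneq (csqn (keyhole_pole (y, t))) 0.
  by rewrite P0 invr0 mulr0 sqr_ge0.
have {}P0 : 0 < csqn (keyhole_pole (y, t)) by rewrite lt_def P0 csqn_ge0.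
rewrite ler_pdivrMr// csqn_keyhole_num_eq csqn_keyhole_pole_eq [leRHS]mulrDr.
apply: lerD; first exact: expR_alphaB1_le.
have /andP[y_1 y_2] : - 1 <= y <= 1 by rewrite -ler_norml.
have k1 : cos t <= cos (alpha * t).
  rewrite leNgt ltr_cos ?alpha_mul_in//.
  by rewrite -leNgt ler_piMl// ltW.
have E1 : expR (alpha * y) <= expR 1.
  rewrite ler_expR; have [yneg|ypos] := leP y 0.
    by rewrite (@le_trans _ _ 0)// pmulr_rle0.
  by rewrite (le_trans _ y_2)// ler_piMl// ltW.
have E2 : 1 <= expR 1 * expR (- y).
  by rewrite -expRD -[leLHS]expR0 ler_expR subr_ge0.
have E0 := expR_gt0 (alpha * y); have c1 := cos_le1 (alpha * t).
have E3 := expR_gt0 (1 : R).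
rewrite -[leLHS]mulrA [leRHS](_ : _ =
  2 * (expR 1 * (expR 1 * expR (- y) * (1 - cos t)))); last by ring.
rewrite ler_pM2l//; apply: (@le_trans _ _ (expR 1 * (1 - cos t))).
  apply: ler_pM; rewrite ?(ltW E0)// ?subr_ge0//.
  by rewrite lerD2l lerN2.
by rewrite ler_pM2l// ler_peMl// subr_ge0 cos_le1.
Qed.

End keyhole_kernel.

(** * The integral of the kernel across the strip *)

Section keyhole_integral.
Context (R : realType).
Local Notation mu := (@lebesgue_measure R).
Implicit Types (y t : R).

Lemma continuous_rectangle_bounded (h : R * R -> R) (a b c d : R) :
  (forall y t, a <= y <= b -> c <= t <= d -> {for (y, t), continuous h}) ->
  exists M, forall y t, a <= y <= b -> c <= t <= d -> `|h (y, t)| <= M.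
Proof.
move=> ch; pose K := `[a, b]%classic `*` `[c, d]%classic : set (R * R).
have cK : compact K by apply: compact_setX; exact: segment_compact.
have /compact_bounded : compact (h @` K).
  apply: continuous_compact cK; apply: continuous_in_subspaceT => -[y t].
  by rewrite inE /K/= !in_itv/= => -[]; exact: ch.
case=> M [_ hM'].
have hM := hM' (M + 1); rewrite ltrDl ltr01 in hM; have {hM' hM}hM := hM isT.
exists (M + 1) => y t yab tcd; apply: hM.
by exists (y, t) => //; split; rewrite /= in_itv.
Qed.

Variables (alpha c : R).
Hypotheses (alpha0 : 0 < alpha) (alpha1 : alpha < 1) (c0 : 0 < c).

(** Leaving out t = 0 keeps the singular point of the kernel outside the domain even when y = 0. *)
Definition keyhole_integral y : R := (\int[mu]_(t in `]0%R, pi]) (keyhole alpha c (y, t)).1)%R.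

Let keyhole_continuous y t : 0 <= t <= pi -> (y != 0) || (0 < t <= pi) ->
  {for t, continuous (fun t => (keyhole alpha c (y, t)).1)}.
Proof.
move=> t01 yt; have [G hG] := holo_keyhole alpha0 alpha1 c0.
have [_ _ d3 _ _] := hG _ _ t01 yt.
by apply/differentiable_continuous/derivable1_diffP.
Qed.

Let keyhole_continuousl y t : 0 <= t <= pi -> (y != 0) || (0 < t <= pi) ->
  {for y, continuous (fun y => (keyhole alpha c (y, t)).1)}.
Proof.
move=> t01 yt; have [G hG] := holo_keyhole alpha0 alpha1 c0.
have [d1 _ _ _ _] := hG _ _ t01 yt.
by apply/differentiable_continuous/derivable1_diffP.
Qed.

Lemma measurable_keyhole y :
  measurable_fun `]0, pi] (fun t => (keyhole alpha c (y, t)).1).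
Proof.
apply: subspace_continuous_measurable_fun => //.
apply: continuous_in_subspaceT => t; rewrite inE/= in_itv/= => t0p.
by apply: keyhole_continuous; rewrite ?t0p ?orbT//; case/andP: t0p => /ltW -> ->.
Qed.

Lemma integrable_keyhole y M : (forall t, 0 < t <= pi -> `|(keyhole alpha c (y, t)).1| <= M) ->
  mu.-integrable `]0, pi] (EFin \o (fun t => (keyhole alpha c (y, t)).1)).
Proof.
move=> hM; apply: measurable_bounded_integrable => //.
- by rewrite /= lebesgue_measure_itv/= lte_fin pi_gt0 -EFinD ltry.
- exact: measurable_keyhole.
- exists M; split; first exact: num_real.
  by move=> x Mx t /=; rewrite in_itv/= => t0p; rewrite (le_trans _ (ltW Mx))// hM.
Qed.

Lemma integrable_keyhole_neq0 y : y != 0 ->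
  mu.-integrable `]0, pi] (EFin \o (fun t => (keyhole alpha c (y, t)).1)).
Proof.
move=> y0; have [G hG] := holo_keyhole alpha0 alpha1 c0.
have [|M hM] := @continuous_rectangle_bounded (fun q => (keyhole alpha c q).1) y y 0 pi.
  move=> y' t; rewrite -eq_le => /eqP <- t01.
  by have [_ _ _ _ []] := hG y t t01 (introT orP (or_introl y0)).
by apply: (@integrable_keyhole _ M) => t /andP[t0 tp]; rewrite hM ?lexx// (ltW t0).
Qed.

(** Differentiation under the integral sign yields the integral of the y-derivative of the real
    part, which is the t-derivative of the imaginary part; hence only the boundary values at t = 0
    and t = pi remain. *)
Lemma is_derive_keyhole_integral y : y != 0 ->
  is_derive y 1 keyhole_integral (keyhole alpha c (y, pi)).2.
Proof.
move=> y0; have [G hG] := holo_keyhole alpha0 alpha1 c0.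
(* A neighbourhood of y avoiding 0, on which the kernel is holomorphic up to t = 0 and its
   derivative is bounded by compactness. *)
have [u [v [/andP[uy yv] uv0]]] : exists u v : R, u < y < v /\
    forall z, u <= z <= v -> z != 0.
  have [yneg|ypos|ye] := ltgtP y 0; last by rewrite ye eqxx in y0.
  - exists (2 * y), (y / 2); split; first by apply/andP; split; lra.
    by move=> z /andP[_ z1]; rewrite lt_eqF//; lra.
  - exists (y / 2), (2 * y); split; first by apply/andP; split; lra.
    by move=> z /andP[z1 _]; rewrite gt_eqF//; lra.
have [|M hM] := @continuous_rectangle_bounded (fun q => (G q).1) u v 0 pi.
  move=> z t zuv t01.
  by have [_ _ _ _ []] := hG z t t01 (introT orP (or_introl (uv0 z zuv))).
have M0 : 0 <= M.
  by apply: le_trans (hM y 0 _ _); rewrite ?normr_ge0// ?(ltW uy) ?(ltW yv) ?lexx ?pi_ge0.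
have uvW z : `]u, v[%classic z -> u <= z <= v.
  by rewrite /= in_itv/= => /andP[/ltW -> /ltW ->].
have Bt t : `]0, pi]%classic t -> 0 <= t <= pi.
  by rewrite /= in_itv/= => /andP[/ltW -> ->].
have Iy : `]u, v[%classic y by rewrite /= in_itv/= uy.
have pE z t : `]u, v[%classic z -> `]0, pi]%classic t ->
    is_derive z 1 (fun z => (keyhole alpha c (z, t)).1) (G (z, t)).1.
  move=> Iz tB.
  by have [] := hG z t (Bt t tB) (introT orP (or_introl (uv0 z (uvW z Iz)))).
pose f z t := (keyhole alpha c (z, t)).1.
have d1E z t : `]u, v[%classic z -> `]0, pi]%classic t ->
    partial1of2 f z t = (G (z, t)).1.
  by move=> Iz tB; rewrite partial1of2E; have d := pE z t Iz tB; rewrite derive_val.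
have h1 z : `]u, v[%classic z -> mu.-integrable `]0, pi] (EFin \o f z).
  by move=> Iz; apply: integrable_keyhole_neq0; exact/uv0/uvW.
have h2 z t : `]u, v[%classic z -> `]0, pi]%classic t -> derivable (f ^~ t) z 1.
  by move=> Iz tB; have d := pE z t Iz tB; exact: ex_derive.
have h3 : mu.-integrable `]0, pi] (EFin \o (fun _ : R => M)).
  apply: measurable_bounded_integrable => //.
    by rewrite /= lebesgue_measure_itv/= lte_fin pi_gt0 -EFinD ltry.
  exact: bounded_cst.
have h4 z t : `]u, v[%classic z -> `]0, pi]%classic t -> `|partial1of2 f z t| <= M.
  by move=> Iz tB; rewrite d1E// hM ?uvW ?Bt.
have D1 : derivable keyhole_integral y 1.
  by apply: (@derivable_under_integral _ _ _ mu f `]0, pi]%classic _ y u v _ h1 h2 (fun=> M)).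
have D2 : derive1 keyhole_integral y = (\int[mu]_(t in `]0%R, pi]) partial1of2 f y t)%R.
  by apply: (@differentiation_under_integral _ _ _ mu f `]0, pi]%classic _ y u v _ h1 h2 (fun=> M)).
apply: DeriveDef; first exact: D1.
rewrite -derive1E D2.
have dQ t : 0 <= t <= pi -> is_derive t 1 (fun t => (keyhole alpha c (y, t)).2) (G (y, t)).1.
  by move=> t01; have [] := hG y t t01 (introT orP (or_introl y0)).
have cG t : 0 <= t <= pi -> {for t, continuous (fun t => (G (y, t)).1)}.
  move=> t01; have [_ _ _ _ [_ _ c3 _]] := hG y t t01 (introT orP (or_introl y0)).
  apply: (@continuous_comp _ _ _ (fun t => (y, t)) (fun q => (G q).1)) => //.
  by apply: (@cvg_pair _ _ _ _ (nbhs y) (nbhs t)); [exact: cvg_cst|exact: cvg_id].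
have cGw : {within `[0, pi], continuous (fun t => (G (y, t)).1)}.
  by apply: continuous_in_subspaceT => t; rewrite inE/= in_itv/=; exact: cG.
have iG : mu.-integrable `[0, pi] (EFin \o (fun t => (G (y, t)).1)).
  by apply: continuous_compact_integrable => //; exact: segment_compact.
transitivity (\int[mu]_(t in `]0%R, pi]) (G (y, t)).1)%R.
  by apply: eq_Rintegral => t; rewrite inE => tB; rewrite d1E.
rewrite Rintegral_itv_obnd_cbnd; last first.
  by apply: integrableS iG => //; exact: subset_itv_oc_cc.
have FTC : (\int[mu]_(t in `[0%R, pi]) ((G (y, t)).1)%:E =
    ((keyhole alpha c (y, pi)).2)%:E - ((keyhole alpha c (y, 0)).2)%:E)%E.
  apply: (@continuous_FTC2 _ _ (fun t => (keyhole alpha c (y, t)).2)) => //.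
  - exact: pi_gt0.
  - have cQ t : 0 <= t <= pi -> {for t, continuous (fun t => (keyhole alpha c (y, t)).2)}.
      by move=> /dQ d; apply/differentiable_continuous/derivable1_diffP.
    split.
    + by move=> t; rewrite in_itv/= => /andP[/ltW t0 /ltW tp]; have := dQ t; rewrite t0 tp => -[].
    + by apply: cvg_at_right_filter; apply: cQ; rewrite lexx pi_ge0.
    + by apply: cvg_at_left_filter; apply: cQ; rewrite lexx pi_ge0.
  - move=> t; rewrite in_itv/= => /andP[/ltW t0 /ltW tp]; rewrite derive1E.
    by have := dQ t; rewrite t0 tp => /(_ isT) d; rewrite derive_val.
(* On the real axis every factor of the kernel is real, so the lower boundary term vanishes. *)
rewrite /Rintegral FTC [X in (_ - X%:E)%E](_ : _ = 0) ?sube0//.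
rewrite /keyhole /keyhole_num /keyhole_den /keyhole_pole /caffine /cexp /cinv /=.
by rewrite !mulr0 sin0 !mulr0 oppr0 !mul0r !mulr0 !addr0 mul0r addr0.
Qed.

(** For each fixed t > 0 the kernel is continuous in y through 0, and the uniform bound near the
    removable singularity serves as domination. *)
Lemma continuous_keyhole_integral0 : {for 0, continuous keyhole_integral}.
Proof.
pose M := expR 1 / sin (pi * alpha).
have s0 : 0 < sin (pi * alpha) by exact: sin_alpha_gt0.
have M0 : 0 <= M by rewrite divr_ge0 ?expR_ge0// ltW.
pose f y t := (keyhole alpha c (y, t)).1.
have hM y t : `]-1, 1[%classic y -> `]0, pi]%classic t -> `|f y t| <= M.
  rewrite /= !in_itv/= => /andP[y1 y2] /andP[/ltW t0 tp].
  rewrite -(ler_pXn2r (n := 2)) ?nnegrE// real_normK ?num_real//.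
  rewrite (le_trans (sqr_re_le_csqn _))// expr_div_n keyhole_bounded ?t0//.
  by rewrite ler_norml !ltW.
have h1 y : `]-1, 1[%classic y -> mu.-integrable `]0, pi] (EFin \o f y).
  by move=> yI; apply: (@integrable_keyhole _ M) => t t0p; apply: hM => //=; rewrite in_itv.
have h2 : {ae mu, forall t, `]0, pi]%classic t ->
    {in (`]-1, 1[%classic : set R), continuous (f ^~ t)}}.
  apply: aeW => t /=; rewrite in_itv/= => t0p y _.
  by apply: keyhole_continuousl; rewrite ?t0p ?orbT//; case/andP: t0p => /ltW -> ->.
have h3 : mu.-integrable `]0, pi] (EFin \o (fun _ : R => M)).
  apply: measurable_bounded_integrable => //.
    by rewrite /= lebesgue_measure_itv/= lte_fin pi_gt0 -EFinD ltry.
  exact: bounded_cst.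
have h4 y : `]-1, 1[%classic y -> {ae mu, forall t, `]0, pi]%classic t -> `|f y t| <= M}.
  by move=> yI; apply: aeW => t; exact: hM.
have := @continuity_under_integral _ _ _ mu f `]0, pi]%classic _ (-1) 1 h1 h2 _ h3 h4.
by apply=> //; rewrite inE/= in_itv/= ltrN10 ltr01.
Qed.

Lemma keyhole_integral_dist y k e : y != 0 ->
  (forall t, 0 <= t <= pi -> `|(keyhole alpha c (y, t)).1 - k| <= e) ->
  `|keyhole_integral y - k * pi| <= e * pi.
Proof.
move=> y0 he; have p0 := pi_gt0 R.
have ic (r : R) : mu.-integrable `]0, pi] (EFin \o (fun _ : R => r)).
  apply: measurable_bounded_integrable => //.
    by rewrite /= lebesgue_measure_itv/= lte_fin pi_gt0 -EFinD ltry.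
  exact: bounded_cst.
have Ic (r : R) : (\int[mu]_(t in `]0%R, pi]) r = r * pi)%R.
  by rewrite Rintegral_cst//= lebesgue_measure_itv/= lte_fin p0 -EFinD/= subr0.
have iG := integrable_keyhole_neq0 y0.
have iB : mu.-integrable `]0, pi] (EFin \o (fun t => (keyhole alpha c (y, t)).1 - k)).
  rewrite (_ : _ \o _ = ((EFin \o (fun t => (keyhole alpha c (y, t)).1)) \- (EFin \o (fun=> k)))%E).
    exact: integrableB.
  by apply/funext => t; rewrite /= EFinB.
rewrite -(Ic k) -(Ic e) /keyhole_integral -RintegralB//.
apply: le_trans (le_normr_Rintegral _ iB) _ => //.
apply: le_Rintegral => //.
  rewrite (_ : _ \o _ = abse \o (EFin \o (fun t => (keyhole alpha c (y, t)).1 - k)))//.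
  exact: integrable_abse.
by move=> t /=; rewrite in_itv/= => /andP[/ltW t0 tp]; rewrite he ?t0.
Qed.

(** For y < 0 the numerator has modulus at most 2, the denominator at least sin(pi alpha), and the
    pole at least e^(-y) - 1 >= - y. Decay in 1/|y| is all that the limit requires. *)
Lemma keyhole_integral_Ny y : y < 0 ->
  `|keyhole_integral y| <= 2 / (sin (pi * alpha) * - y) * pi.
Proof.
move=> yneg; have s0 : 0 < sin (pi * alpha) by exact: sin_alpha_gt0.
rewrite -[X in `|X|]subr0 -[X in `|_ - X|](mul0r pi).
apply: keyhole_integral_dist => [|t t01]; first by rewrite lt_eqF.
have y0 : 0 < - y by rewrite oppr_gt0.
rewrite subr0 -(ler_pXn2r (n := 2)) ?nnegrE ?divr_ge0 ?mulr_ge0 ?(ltW s0) ?(ltW y0)//.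
rewrite real_normK ?num_real// (le_trans (sqr_re_le_csqn _))// csqn_keyhole.
rewrite expr_div_n exprMn invfM mulrA.
have h1 : csqn (keyhole_num alpha (y, t)) <= 2 ^+ 2.
  rewrite csqn_keyhole_num_eq; have := expR_gt0 (alpha * y).
  have : expR (alpha * y) <= 1 by rewrite -[leRHS]expR0 ler_expR pmulr_rle0// ltW.
  have := cos_geN1 (alpha * t); have := cos_le1 (alpha * t).
  by move: (expR _) (cos _) => E k; nra.
have D1 := csqn_keyhole_den alpha0 alpha1 c0 y t01.
have P1 : (- y) ^+ 2 <= csqn (keyhole_pole (y, t)).
  apply: le_trans (csqn_keyhole_pole y t).
  rewrite -[leRHS]sqrrN opprB ler_pXn2r ?nnegrE ?(ltW y0)//.
    by rewrite lerBrDl expR_ge1Dx.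
  by rewrite subr_ge0 -[leLHS]expR0 ler_expR ltW.
have sq0 : 0 < sin (pi * alpha) ^+ 2 by rewrite exprn_gt0.
have yq0 : 0 < (- y) ^+ 2 by rewrite exprn_gt0.
rewrite ler_pM ?mulr_ge0 ?invr_ge0 ?csqn_ge0//.
  by rewrite ler_pM ?invr_ge0 ?csqn_ge0// lef_pV2 ?posrE// (lt_le_trans sq0).
by rewrite lef_pV2 ?posrE// (lt_le_trans yq0).
Qed.

(** Write d for the denominator and q for the pole. The kernel minus its limit 1/c equals ((1 - q) d
    - (1 + c)) / (c d q), where 1 - q = e^(-z). Since |d| grows and |q| stays above 1/2, both
    contributions are O(1/y). *)
Lemma keyhole_integral_y : exists K, forall y, 1 <= y -> 2 <= c * alpha * y ->
  `|keyhole_integral y - pi / c| <= K / y * pi.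
Proof.
(* The factor 8 is 2, from |a - b|^2 <= 2|a|^2 + 2|b|^2, times 4 >= 1/|q|^2. The first summand comes
   from |d| >= c e^(alpha y) - 1 >= c alpha y / 2, the second from e^(-y) <= 1/y. *)
pose K2 := 8 / c ^+ 2 * (4 * (1 + c) ^+ 2 / (c * alpha) ^+ 2 + 1).
have ca0 : 0 < c * alpha by rewrite mulr_gt0.
have K20 : 0 <= K2.
  by rewrite mulr_ge0 ?addr_ge0 ?divr_ge0 ?mulr_ge0 ?addr_ge0 ?(ltW c0) ?(ltW alpha0).
exists (Num.sqrt K2) => y y1 y2.
have y0 : 0 < y by lra.
rewrite [pi / c]mulrC; apply: keyhole_integral_dist => [|t t01]; first by rewrite gt_eqF.
rewrite -(ler_pXn2r (n := 2)) ?nnegrE ?divr_ge0 ?sqrtr_ge0 ?(ltW y0)//.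
rewrite real_normK ?num_real// expr_div_n sqr_sqrtr//.
have s0 : 0 < sin (pi * alpha) by exact: sin_alpha_gt0.
have D1 := csqn_keyhole_den alpha0 alpha1 c0 y t01.
have D0 : 0 < csqn (keyhole_den alpha c (y, t)) by rewrite (lt_le_trans _ D1)// exprn_gt0.
have P0 : 0 < csqn (keyhole_pole (y, t)).
  by apply: csqn_keyhole_pole_gt0; rewrite gt_eqF.
pose d := keyhole_den alpha c (y, t); pose q := keyhole_pole (y, t).
pose m : R * R := cmul (1 - q.1, - q.2) d.
have -> : (keyhole alpha c (y, t)).1 - c^-1 =
    (cmul (cmul ((m.1 - (1 + c)) / c, m.2 / c) (cinv d)) (cinv q)).1.
  rewrite /keyhole -/d -/q.
  have -> : keyhole_num alpha (y, t) = ((d.1 - 1) / c - 1, d.2 / c).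
    by rewrite /keyhole_num /d /keyhole_den /caffine/=; congr pair; field; rewrite gt_eqF.
  move: (lt0r_neq0 D0) (lt0r_neq0 P0); rewrite -/d -/q /m.
  case: d q {m} => [d1 d2] [q1 q2]; rewrite /cmul /cinv /csqn /=.
  by move=> dN0 qN0; field; rewrite dN0 qN0 gt_eqF.
apply: le_trans (sqr_re_le_csqn _) _; rewrite !csqnM !csqnV.
have -> : csqn ((m.1 - (1 + c)) / c, m.2 / c) =
    ((m.1 - (1 + c)) ^+ 2 + m.2 ^+ 2) / c ^+ 2.
  by rewrite /csqn/=; field; rewrite gt_eqF.
have mN : csqn m = expR (- y) ^+ 2 * csqn d.
  rewrite csqnM; congr (_ * _).
  rewrite (_ : (_, _) = cexp (-1) (y, t)).
    rewrite (_ : cexp (-1) (y, t) = caffine 0 1 (cexp (-1) (y, t))).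
      by rewrite csqn_caffine_cexp !mulN1r; ring.
    by rewrite /caffine !mul1r add0r; case: (cexp _ _).
  by rewrite /q /keyhole_pole /caffine/=; congr pair; ring.
have h1 : (m.1 - (1 + c)) ^+ 2 + m.2 ^+ 2 <= 2 * (1 + c) ^+ 2 + 2 * csqn m.
  by rewrite /csqn; have := sqr_ge0 (m.1 + (1 + c)); have := sqr_ge0 m.2; nra.
have cE : c * alpha * y / 2 <= c * expR (alpha * y) - 1.
  have := expR_ge1Dx (alpha * y); rewrite -(ler_pM2l c0) mulrDr mulr1 [c * (alpha * y)]mulrA.
  move: y2 c0; move: (c * alpha * y) (c * expR _) => A E y2 c0' hE; lra.
have dN : (c * alpha * y / 2) ^+ 2 <= csqn d.
  rewrite csqn_caffine_cexp.
  have E0 : 0 <= c * alpha * y / 2 by rewrite divr_ge0 ?mulr_ge0 ?(ltW y0) ?(ltW c0) ?(ltW alpha0).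
  apply: (@le_trans _ _ ((c * expR (alpha * y) - 1) ^+ 2)).
    by rewrite ler_pXn2r ?nnegrE// (le_trans E0).
  rewrite (_ : 1 ^+ 2 + 2 * 1 * c * _ * _ + _ =
    (c * expR (alpha * y) - 1) ^+ 2 + 2 * (c * expR (alpha * y) * (1 + cos (alpha * t)))); last by ring.
  rewrite lerDl !mulr_ge0 ?(ltW c0) ?expR_ge0//.
have ey : expR (- y) <= y^-1.
  by rewrite expRN lef_pV2 ?posrE ?expR_gt0// (le_trans _ (expR_ge1Dx y))// lerDr.
have ey2 : expR (- y) <= 1 / 2.
  rewrite expRN div1r lef_pV2 ?posrE ?expR_gt0// (le_trans _ (expR_ge1Dx y))//.
  by lra.
have qN : (1 / 2) ^+ 2 <= csqn q.
  apply: le_trans (csqn_keyhole_pole y t).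
  rewrite ler_pXn2r ?nnegrE//; lra.
have c20 : 0 < c ^+ 2 by rewrite exprn_gt0.
have ca20 : 0 < (c * alpha) ^+ 2 by rewrite exprn_gt0.
have yq0 : 0 < y ^+ 2 by rewrite exprn_gt0.
have D'0 : 0 < csqn d by exact: D0.
have Q'0 : 0 < csqn q by exact: P0.
have dV : (csqn d)^-1 <= 4 / (c * alpha) ^+ 2 / y ^+ 2.
  rewrite (_ : 4 / _ / _ = ((c * alpha * y / 2) ^+ 2)^-1); last first.
    by field; rewrite !gt_eqF.
  by rewrite lef_pV2// posrE exprn_gt0// divr_gt0// mulr_gt0.
have qV : (csqn q)^-1 <= 4.
  by rewrite -[leRHS]invrK lef_pV2 ?posrE// (le_trans _ qN)//; lra.
have ee : expR (- y) ^+ 2 <= (y ^+ 2)^-1.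
  by rewrite -exprVn ler_pXn2r ?nnegrE ?expR_ge0 ?invr_ge0 ?(ltW y0).
apply: (@le_trans _ _ ((2 * (1 + c) ^+ 2 + 2 * csqn m) / c ^+ 2 / csqn d * 4)).
  rewrite ler_pM ?invr_ge0 ?csqn_ge0//.
    by rewrite !mulr_ge0 ?invr_ge0 ?addr_ge0 ?sqr_ge0 ?csqn_ge0.
  by rewrite ler_wpM2r ?invr_ge0 ?csqn_ge0// ler_wpM2r ?invr_ge0 ?sqr_ge0.
rewrite mN (_ : _ * 4 = 8 / c ^+ 2 * ((1 + c) ^+ 2 * (csqn d)^-1 + expR (- y) ^+ 2)); last first.
  by field; rewrite !gt_eqF.
rewrite (_ : K2 / y ^+ 2 = 8 / c ^+ 2 * ((1 + c) ^+ 2 *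
    (4 / (c * alpha) ^+ 2 / y ^+ 2) + (y ^+ 2)^-1)); last first.
  by rewrite /K2; field; rewrite !gt_eqF.
rewrite ler_wpM2l ?divr_ge0 ?sqr_ge0//; apply: lerD => //.
by rewrite ler_wpM2l ?sqr_ge0.
Qed.

End keyhole_integral.

(** * Evaluation of the Stieltjes transform *)

Section stieltjes_density.
Context (R : realType) (alpha : R).
Hypotheses (alpha0 : 0 < alpha) (alpha1 : alpha < 1).
Local Notation mu := (@lebesgue_measure R).
Implicit Types (x y s : R).

Lemma keyhole_integral_cvgNy (c : R) : 0 < c ->
  keyhole_integral alpha c y @[y --> -oo] --> (0 : R).
Proof.
move=> c0; have s0 : 0 < sin (pi * alpha) by exact: sin_alpha_gt0.
apply/cvgrPdist_le => e e0; near=> y.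
rewrite sub0r normrN.
have y0 : y < 0 by near: y; apply: nbhs_ninfty_lt; exact: num_real.
apply: le_trans (keyhole_integral_Ny alpha0 alpha1 c0 y0) _.
have yM : y <= - (2 / sin (pi * alpha) * pi / e) by near: y; apply: nbhs_ninfty_le; exact: num_real.
rewrite (_ : _ * pi = 2 / sin (pi * alpha) * pi / - y); last first.
  by field; rewrite (gt_eqF s0) (lt_eqF y0).
by rewrite ler_pdivrMr ?oppr_gt0// [e * _]mulrC -ler_pdivrMr// lerNr.
Unshelve. all: by end_near. Qed.

Lemma keyhole_integral_cvgy (c : R) : 0 < c ->
  keyhole_integral alpha c y @[y --> +oo] --> pi / c.
Proof.
move=> c0; have [K hK] := keyhole_integral_y alpha0 alpha1 c0.
apply/cvgrPdist_le => e e0; near=> y.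
have y1 : 1 <= y by near: y; apply: nbhs_pinfty_ge; exact: num_real.
rewrite distrC (le_trans (hK y y1 _))//.
  have : 2 / (c * alpha) <= y by near: y; apply: nbhs_pinfty_ge; exact: num_real.
  by rewrite ler_pdivrMr ?mulr_gt0// [y * _]mulrC.
have yM : K * pi / e <= y by near: y; apply: nbhs_pinfty_ge; exact: num_real.
rewrite mulrAC ler_pdivrMr ?(lt_le_trans ltr01 y1)// [e * y]mulrC -ler_pdivrMr//.
Unshelve. all: by end_near. Qed.

Lemma continuous_keyhole_integral (c : R) : 0 < c -> continuous (keyhole_integral alpha c).
Proof.
move=> c0 y; have [->|y0] := eqVneq y 0; first exact: continuous_keyhole_integral0.
have d := is_derive_keyhole_integral alpha0 alpha1 c0 y0.
by apply/differentiable_continuous/derivable1_diffP.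
Qed.

(** On the upper edge e^(-z) = - e^(-y), so the pole becomes the real number 1 + e^(-y), which is (x
    + s) / x for x = s e^y; the squared modulus of the other factor is the denominator of the
    density at x^alpha = c e^(alpha y). *)
Lemma keyhole_pi2 (c y : R) : 0 < c -> (keyhole alpha c (y, pi)).2 =
  (1 + c) * sin (pi * alpha) * expR (alpha * y) /
  stable_ratio_denom alpha (c * expR (alpha * y)) / (1 + expR (- y)).
Proof.
move=> c0; have E0 := expR_gt0 (alpha * y); have e0 := expR_gt0 (- y).
have D0 := stable_ratio_denom_gt0 (c * expR (alpha * y)) alpha0 alpha1.
have dE : csqn (keyhole_den alpha c (y, pi)) = stable_ratio_denom alpha (c * expR (alpha * y)).
  by rewrite csqn_caffine_cexp /stable_ratio_denom [pi * alpha]mulrC; ring.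
have qE : keyhole_pole (y, pi) = (1 + expR (- y), 0).
  by rewrite /keyhole_pole /caffine /cexp/= !mulN1r sinN cosN sinpi cospi; congr pair; ring.
have q2 : csqn (1 + expR (- y), 0) = (1 + expR (- y)) ^+ 2 by rewrite /csqn/= expr0n addr0.
rewrite /keyhole qE /cmul /cinv/= dE q2 oppr0 mul0r mulr0 add0r.
rewrite /keyhole_num /keyhole_den /caffine/= [alpha * pi]mulrC.
move: (stable_ratio_denom _ _) D0 => N D0; move: (sin _) (cos _) => S C.
by field; rewrite !gt_eqF// addr_gt0.
Qed.

Lemma continuous_stable_ratio_density x : 0 < x ->
  {for x, continuous (stable_ratio_density alpha)}.
Proof.
move=> x0.
have cp b : {for x, continuous (fun x => x `^ b)}.
  apply/differentiable_continuous/derivable1_diffP.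
  by apply: derivable_powR; rewrite in_itv/= x0.
have cD : {for x, continuous (fun x => stable_ratio_denom alpha (x `^ alpha))}.
  apply: cvgD; last exact: cvg_cst.
  apply: cvgD; last by apply: cvgMl_tmp; exact: cp.
  by rewrite expr2; under eq_fun do rewrite expr2; exact: cvgM (cp _) (cp _).
apply: cvgM; first by apply: cvgMl_tmp; exact: cp.
by apply: cvgV cD; rewrite gt_eqF// stable_ratio_denom_gt0.
Qed.

Lemma stieltjes_stable_ratio_density s : 0 < s ->
  (\int[mu]_(x in `]0%R, +oo[) (stable_ratio_density alpha x * (x / (x + s)))%:E
   = ((1 + s `^ alpha)^-1)%:E)%E.
Proof.
move=> s0; pose c := s `^ alpha; have c0 : 0 < c by exact: powR_gt0.
(* [K] turns the boundary value (1 + c) sin(pi alpha) e^(alpha y) / ... into sin(pi alpha) / pi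
   times x^alpha / ..., and the limit pi / c at +oo into 1 / (1 + c). The exceptional point y = 0 is
   x = s. *)
pose K := c / (pi * (1 + c)).
have pi0 := pi_gt0 R; have c1 : 0 < 1 + c by rewrite addr_gt0.
pose F x := K * keyhole_integral alpha c (ln x - ln s).
have -> : (1 + c)^-1 = K * (pi / c) - K * 0.
  rewrite /K mulr0 subr0; move: (@pi R) pi0 => p p0.
  by field; rewrite !gt_eqF.
have dln x : 0 < x -> is_derive x 1 (fun x => ln x - ln s) x^-1.
  by move=> x0; have := is_derive1_ln x0 => d; apply: is_derive_eq; rewrite subr0.
have cln x : 0 < x -> {for x, continuous (fun x => ln x - ln s)}.
  by move=> /dln d; apply/differentiable_continuous/derivable1_diffP.
apply: (@ge0_integral_0y _
  (fun x => stable_ratio_density alpha x * (x / (x + s))) F s).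
- move=> x x0; have f0 := stable_ratio_density_gt0 alpha0 alpha1 x0.
  by rewrite ltW// mulr_gt0// divr_gt0// addr_gt0.
- move=> x x0; apply: cvgM; first exact: continuous_stable_ratio_density.
  apply: cvgM; first exact: cvg_id.
  apply: cvgV; first by rewrite gt_eqF// addr_gt0.
  by apply: cvgD; [exact: cvg_id|exact: cvg_cst].
- move=> x x0; apply: cvgMl_tmp.
  apply: (@continuous_comp _ _ _ (fun x => ln x - ln s) (keyhole_integral alpha c)).
    exact: cln.
  exact: continuous_keyhole_integral.
- move=> x x0 xs.
  have y0 : ln x - ln s != 0.
    by rewrite subr_eq0 (inj_in_eq (@ln_inj R)) ?posrE.
  have d := is_derive_keyhole_integral alpha0 alpha1 c0 y0.
  have d' := @is_derive1_comp _ _ (fun x => ln x - ln s) x _ _ d (dln x x0).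
  apply: (is_derive_eq (is_deriveZ K d')).
  rewrite keyhole_pi2// /GRing.scale/=.
  have -> : expR (- (ln x - ln s)) = s / x.
    by rewrite opprB expRB !lnK.
  have eE : expR (alpha * (ln x - ln s)) = x `^ alpha / s `^ alpha.
    by rewrite mulrBr expRB /powR !gt_eqF.
  have cE : c * (x `^ alpha / c) = x `^ alpha by field; rewrite gt_eqF.
  rewrite eE -/c cE.
  have D0 := stable_ratio_denom_gt0 (x `^ alpha) alpha0 alpha1.
  rewrite /stable_ratio_density /K.
  have -> : x `^ (alpha - 1) = x `^ alpha / x.
    by rewrite powRB ?powRr1 ?(gt_eqF x0) ?implybT// ltW.
  move: (sin _) => S; move: (@pi R) pi0 => p p0.
  by field; rewrite !gt_eqF// addr_gt0.
- apply: cvgMl_tmp.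
  apply: (cvg_comp (fun x => ln x - ln s) (keyhole_integral alpha c) _
    (keyhole_integral_cvgNy c0)).
  exact: (cvg_comp (@ln R) (fun x => x - ln s) (@lnNy R) (cvg_addrr_Ny (- ln s))).
- apply: cvgMl_tmp.
  apply: (cvg_comp (fun x => ln x - ln s) (keyhole_integral alpha c) _
    (keyhole_integral_cvgy c0)).
  apply/cvgryPge => A; near=> x.
  have h : expR (A + ln s) <= x by near: x; apply: nbhs_pinfty_ge; exact: num_real.
  by rewrite lerBrDr -[leLHS]expRK ler_ln ?posrE ?expR_gt0//.
Unshelve. all: by end_near. Qed.

End stieltjes_density.

(** * A law on ]0, +oo[ is determined by its Stieltjes transform *)

Section stieltjes_unique.
Context (R : realType).
Implicit Types (x r s : R) (n k : nat).

Lemma bernoulli_le (t : R) k : 0 <= t <= 1 -> 1 - k%:R * t <= (1 - t) ^+ k.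
Proof.
move=> /andP[t0 t1]; elim: k => [|k IH]; first by rewrite mul0r subr0.
have h : 0 <= k%:R * t ^+ 2 by rewrite mulr_ge0 ?sqr_ge0.
rewrite exprS -natr1; apply: (@le_trans _ _ ((1 - t) * (1 - k%:R * t))).
  by move: h; rewrite expr2; lra.
by rewrite ler_wpM2l// subr_ge0.
Qed.

Lemma onem_exp_le (t : R) k : 0 <= t <= 1 -> (1 - t) ^+ k <= expR (- (k%:R * t)).
Proof.
move=> /andP[t0 t1]; rewrite -mulrN expRM_natl lerXn2r ?nnegrE ?expR_ge0 ?subr_ge0//.
exact: expR_ge1Dx.
Qed.

(** With q = p^2, the factor n p^n stays below 1 / (1 - p), while the remaining p^n tends to 0. *)
Lemma cvg_natM_expr (q : R) : 0 <= q < 1 -> n%:R * q ^+ n @[n --> \oo] --> (0 : R).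
Proof.
move=> /andP[q0 q1]; pose p := Num.sqrt q.
have p0 : 0 <= p by exact: sqrtr_ge0.
have p1 : p < 1 by rewrite -sqrtr1 ltr_sqrt.
have pq : p ^+ 2 = q by rewrite sqr_sqrtr.
have np n : n%:R * p ^+ n <= (1 - p)^-1.
  elim: n => [|n IH]; first by rewrite mul0r invr_ge0 subr_ge0 ltW.
  rewrite -natr1 mulrDl mul1r exprS mulrCA.
  have pn : p ^+ n <= 1 by rewrite exprn_ile1// ltW.
  apply: (@le_trans _ _ (p * (1 - p)^-1 + 1)).
    by apply: lerD; [exact: ler_wpM2l|rewrite mulr_ile1// ?exprn_ge0// ltW].
  have p1' : 1 - p != 0 by rewrite subr_eq0 gt_eqF.
  by rewrite le_eqVlt; apply/orP; left; apply/eqP; field.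
have cp : (1 - p)^-1 * p ^+ n @[n --> \oo] --> (0 : R).
  rewrite -[X in _ --> X](mulr0 (1 - p)^-1).
  by apply: cvgMl_tmp; apply: cvg_expr; rewrite ger0_norm.
apply: (squeeze_cvgr _ (cvg_cst 0) cp); near=> n.
rewrite mulr_ge0 ?exprn_ge0//= -pq -exprM mulnC exprM expr2 mulrA.
by rewrite ler_wpM2r ?exprn_ge0.
Unshelve. all: by end_near. Qed.

Definition step_exponent (c : R) n : nat := (Num.truncn (n%:R / c ^+ n)).

(* [(1 - w^n)^(m_n)] with [m_n ~ n c^(-n)] are polynomials in [w] converging
   pointwise on [[0, 1]] to the indicator of [w < c]. *)
Lemma step_poly_cvg (c w : R) : (0 < c < 1) -> (0 <= w <= 1) ->
  (1 - w ^+ n) ^+ (step_exponent c n) @[n --> \oo] --> ((w < c)%R%:R : R).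
Proof.
move=> /andP[c0 c1] /andP[w0 w1].
have m1 n : (step_exponent c n)%:R <= n%:R / c ^+ n.
  have := @truncn_itv R (n%:R / c ^+ n).
  by rewrite divr_ge0 ?exprn_ge0 ?(ltW c0)// => /(_ isT) /andP[].
have m2 n : n%:R / c ^+ n < (step_exponent c n).+1%:R by exact: truncnS_gt.
have [wc|cw] := ltP w c.
  (* Below c, Bernoulli's inequality gives at least 1 - m_n w^n >= 1 - n (w/c)^n. *)
  have q1 : 0 <= w / c < 1 by rewrite divr_ge0 ?(ltW c0)// ltr_pdivrMr// mul1r.
  have h : 1 - n%:R * (w / c) ^+ n @[n --> \oo] --> (1 - 0 : R).
    by apply: cvgB; [exact: cvg_cst|exact: cvg_natM_expr].
  rewrite subr0 in h.
  rewrite [X in _ --> X](_ : _ = 1)//.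
  apply: (squeeze_cvgr _ h (@cvg_cst R^o 1 _ _ _)); near=> n.
  have wn : 0 <= w ^+ n <= 1 by rewrite exprn_ge0//= exprn_ile1.
  apply/andP; split; last first.
    by rewrite exprn_ile1// ?subr_ge0 ?(andP wn).2// gerBl (andP wn).1.
  apply: le_trans (bernoulli_le _ wn); rewrite lerD2l lerN2 expr_div_n mulrA mulrAC.
  by rewrite ler_wpM2r// (andP wn).1.
(* From c on, the value is at most e^(- m_n w^n) with m_n w^n >= m_n c^n > n - c^n >= n - 1; the
   factor e pays for the truncation in m_n. *)
have h : expR 1 * expR (- n%:R) @[n --> \oo] --> (expR 1 * 0 : R).
  by apply: cvgMl_tmp; exact: cvgn_expR.
rewrite mulr0 in h.
rewrite [X in _ --> X](_ : _ = 0)//.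
apply: (squeeze_cvgr _ (cvg_cst 0) h); near=> n.
have wn : 0 <= w ^+ n <= 1 by rewrite exprn_ge0//= exprn_ile1.
rewrite exprn_ge0 ?subr_ge0 ?(andP wn).2//=.
apply: le_trans (onem_exp_le _ wn) _; rewrite -expRD ler_expR.
have cn0 : 0 < c ^+ n by rewrite exprn_gt0.
have h1 : c ^+ n <= w ^+ n by rewrite lerXn2r ?nnegrE// ltW.
have h2 : c ^+ n <= 1 by rewrite exprn_ile1// ltW.
have := m2 n; rewrite ltr_pdivrMr// -natr1 mulrDl mul1r => h3.
have h4 : (step_exponent c n)%:R * c ^+ n <= (step_exponent c n)%:R * w ^+ n.
  by rewrite ler_wpM2l.
by lra.
Unshelve. all: by end_near. Qed.

End stieltjes_unique.

Section stieltjes_unique.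
Context (R : realType) (m1 m2 : {measure set R -> \bar R}).
Implicit Types (x r s : R) (n k : nat) (phi psi : R -> R).
Local Notation D := (`]0%R, +oo[%classic : set R).
Hypotheses (m1T : m1 D = 1%E) (m2T : m2 D = 1%E).

(** Measurability and a bound are bundled with the equality so that the class is stable under linear
    combinations and, by dominated convergence, under uniformly bounded pointwise limits. *)
Definition same_integral phi : Prop :=
  [/\ measurable_fun D phi, exists M, forall x, 0 < x -> `|phi x| <= M
    & (\int[m1]_(x in D) phi x = \int[m2]_(x in D) phi x)%R].

Let mD : measurable D. Proof. exact: measurable_itv. Qed.

Lemma bounded_integrable_0y (m : {measure set R -> \bar R}) phi M : m D = 1%E ->
  measurable_fun D phi -> (forall x, 0 < x -> `|phi x| <= M) ->
  m.-integrable D (EFin \o phi).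
Proof.
move=> mT mphi hM; apply: measurable_bounded_integrable => //; first by rewrite mT ltry.
exists M; split; first exact: num_real.
by move=> y My x /=; rewrite in_itv/= andbT => x0; rewrite (le_trans (hM x x0))// ltW.
Qed.

Lemma same_integral_ext phi psi : (forall x, 0 < x -> phi x = psi x) ->
  same_integral phi -> same_integral psi.
Proof.
move=> e [mphi [M hM] I]; have e' : {in D, phi =1 psi}.
  by move=> x; rewrite inE/= in_itv/= andbT; exact: e.
split.
- exact: eq_measurable_fun mphi.
- by exists M => x x0; rewrite -e// hM.
- have e1 (m : {measure set R -> \bar R}) :
      (\int[m]_(x in D) phi x = \int[m]_(x in D) psi x)%R by exact: eq_Rintegral.
  by rewrite -!e1.
Qed.

Lemma same_integralB phi psi : same_integral phi -> same_integral psi ->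
  same_integral (fun x => phi x - psi x).
Proof.
move=> [mphi [M hM] I] [mpsi [N hN] J]; split.
- exact: measurable_funB.
- by exists (M + N) => x x0; rewrite (le_trans (ler_normB _ _))// lerD ?hM ?hN.
- rewrite RintegralB//; [|exact: bounded_integrable_0y hM|exact: bounded_integrable_0y hN].
  rewrite RintegralB//; [|exact: bounded_integrable_0y hM|exact: bounded_integrable_0y hN].
  by rewrite I J.
Qed.

Lemma same_integralZ phi (k : R) : same_integral phi ->
  same_integral (fun x => k * phi x).
Proof.
move=> [mphi [M hM] I]; split.
- exact: measurable_funM.
- by exists (`|k| * M) => x x0; rewrite normrM ler_wpM2l ?hM.
- rewrite RintegralZl//; last exact: bounded_integrable_0y hM.
  by rewrite RintegralZl ?I//; exact: bounded_integrable_0y hM.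
Qed.

Lemma same_integral_cvg (f : nat -> R -> R) phi M :
  (forall n, same_integral (f n)) ->
  (forall n x, 0 < x -> `|f n x| <= M) ->
  (forall x, 0 < x -> f n x @[n --> \oo] --> phi x) -> same_integral phi.
Proof.
move=> hf hM fphi.
have D0 x : D x = (0 < x) :> Prop by rewrite /= in_itv/= andbT.
have mphi : measurable_fun D phi.
  apply: (@measurable_fun_cvg _ _ _ _ f).
    by move=> n; have [] := hf n.
  by move=> x; rewrite D0; exact: fphi.
have hphi x : 0 < x -> `|phi x| <= M.
  move=> x0; apply: (cvgr_to_le (cvg_norm (fphi x x0))).
  by apply: nearW => n; exact: hM.
split => //; first by exists M.
have lim (m : {measure set R -> \bar R}) : m D = 1%E ->
    (\int[m]_(x in D) f n x)%R @[n --> \oo] --> (\int[m]_(x in D) phi x)%R.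
  move=> mT; apply: fine_cvg; rewrite fineK; last first.
    by apply: integrable_fin_num => //; exact: bounded_integrable_0y hphi.
  apply: (@dominated_cvg _ _ _ m _ mD (fun n x => (f n x)%:E) _ (EFin \o (fun=> M))) => //.
  - by move=> n; apply/measurable_EFinP; have [] := hf n.
  - by move=> x; rewrite D0 => x0; apply: cvg_EFin; [exact: nearW|exact: fphi].
  - by apply: (@bounded_integrable_0y _ _ `|M|) => //; exact: measurable_cst.
  - by move=> n x; rewrite D0 => x0; rewrite lee_fin hM.
apply: (@cvg_unique _ (@Rhausdorff R) _ _ _ _ (lim m1 m1T)).
have -> : (fun n => \int[m1]_(x in D) f n x)%R = (fun n => \int[m2]_(x in D) f n x)%R.
  by apply/funext => n; have [] := hf n.
exact: lim.
Qed.

Hypothesis stieltjes : forall s, 0 < s ->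
  (\int[m1]_(x in D) (x / (x + s)) = \int[m2]_(x in D) (x / (x + s)))%R.


Let X x : R := (x + 1)^-1.

Let X0 x : 0 < x -> 0 < X x.
Proof. by move=> x0; rewrite invr_gt0 addr_gt0. Qed.

Let X1 x : 0 < x -> X x < 1.
Proof. by move=> x0; rewrite invf_lt1 ?addr_gt0// ltrDr. Qed.

Let W01 s x : 0 < s -> 0 < x -> 0 < x / (x + s) <= 1.
Proof.
move=> s0 x0; rewrite divr_gt0 ?addr_gt0//=.
by rewrite ler_pdivrMr ?addr_gt0// mul1r lerDl ltW.
Qed.

Let continuous_measurable phi : (forall x, 0 < x -> {for x, continuous phi}) ->
  measurable_fun D phi.
Proof.
move=> cphi; apply: open_continuous_measurable_fun; first exact: interval_open.
by move=> x; rewrite inE/= in_itv/= andbT; exact: cphi.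
Qed.

Let mX : measurable_fun D X.
Proof.
apply: continuous_measurable => x x0; apply: cvgV; first by rewrite gt_eqF ?addr_gt0.
by apply: cvgD; [exact: cvg_id|exact: cvg_cst].
Qed.

Let mW s : 0 < s -> measurable_fun D (fun x => x / (x + s)).
Proof.
move=> s0; apply: continuous_measurable => x x0; apply: cvgM; first exact: cvg_id.
apply: cvgV; first by rewrite gt_eqF ?addr_gt0.
by apply: cvgD; [exact: cvg_id|exact: cvg_cst].
Qed.

Let bWX s n x : 0 < s -> 0 < x -> `|x / (x + s) * X x ^+ n| <= 1.
Proof.
move=> s0 x0; have /andP[w0 w1] := W01 s0 x0; have Xx0 := ltW (X0 x0); have Xx1 := ltW (X1 x0).
have Xn0 : 0 <= X x ^+ n by exact: exprn_ge0.
rewrite ger0_norm; last by rewrite mulr_ge0// ltW.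
by rewrite mulr_ile1// ?exprn_ile1// ltW.
Qed.

(* [x / (x + s) X^n = x / (x + 1) X^n + (1 - s) x / (x + s) X^(n + 1)]; the
   value [s = 1] is recovered from the others by letting [s] tend to [1]. *)
Lemma same_integral_kernel n s : 0 < s <= 1 ->
  same_integral (fun x => x / (x + s) * X x ^+ n).
Proof.
elim: n s => [|n IH] s /andP[s0 s1].
  apply: (@same_integral_ext (fun x => x / (x + s))).
    by move=> x _; rewrite expr0 mulr1.
  split; [exact: mW| |exact: stieltjes].
  by exists 1 => x x0; have := bWX 0 s0 x0; rewrite expr0 mulr1.
have step (u : R) : 0 < u < 1 -> same_integral (fun x => x / (x + u) * X x ^+ n.+1).
  move=> /andP[u0 u1].
  have h1 : 0 < u <= 1 by rewrite u0 ltW.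
  have h2 : 0 < (1 : R) <= 1 by rewrite ltr01 lexx.
  have h := same_integralZ (1 - u)^-1 (same_integralB (IH u h1) (IH 1 h2)).
  apply: same_integral_ext h => x x0.
  have e1 : x + 1 != 0 by rewrite gt_eqF ?addr_gt0.
  have e2 : x + u != 0 by rewrite gt_eqF ?addr_gt0.
  have e3 : 1 - u != 0 by rewrite subr_eq0 gt_eqF.
  by rewrite /X exprS; field; rewrite e1 e2 e3.
have [s1'|s1'] := ltP s 1; first by apply: step; rewrite s0.
have -> : s = 1 by apply/eqP; rewrite eq_le s1 s1'.
(* The parameters 1 - 1/(k+2) lie strictly between 0 and 1 for every k, so the case already proved
   applies to them. *)
apply: (@same_integral_cvg (fun k x => x / (x + (1 - k.+2%:R^-1)) * X x ^+ n.+1) _ 1).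
- move=> k; apply: step; rewrite subr_gt0 invf_lt1// ltr1n/= ltrBlDr ltrDl invr_gt0//.
- by move=> k x x0; apply: bWX => //; rewrite subr_gt0 invf_lt1// ltr1n.
- move=> x x0; apply: cvgM; last exact: cvg_cst.
  apply: cvgM; first exact: cvg_cst.
  apply: cvgV; first by rewrite gt_eqF ?addr_gt0.
  apply: cvgD; first exact: cvg_cst.
  rewrite -[X in _ --> X](subr0 1); apply: cvgB; first exact: cvg_cst.
  have := @cvg_harmonic R.
  by rewrite -(cvg_shiftn 1)/=; under eq_fun do rewrite addn1.
Qed.

(** Because 1 - x / (x + 1) = 1 / (x + 1), the next power is the current one minus the kernel at s =
    1. The power 0 is the equality of total masses. *)
Lemma same_integral_exprn n : same_integral (fun x => X x ^+ n).
Proof.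
elim: n => [|n IH].
  apply: (@same_integral_ext (fun=> 1)) => //; split.
  - exact: measurable_cst.
  - by exists 1 => x _; rewrite normr1.
  - by rewrite !Rintegral_cst//= m1T m2T.
have h1 : 0 < (1 : R) <= 1 by rewrite ltr01 lexx.
apply: same_integral_ext (same_integralB IH (same_integral_kernel n h1)) => x x0.
by rewrite /X exprS; field; rewrite gt_eqF// addr_gt0.
Qed.

(** The extra exponent [a] makes the induction close: one more factor 1 - X^n splits into the
    exponents a and a + n. *)
Lemma same_integral_bernstein a n k :
  same_integral (fun x => X x ^+ a * (1 - X x ^+ n) ^+ k).
Proof.
elim: k a => [|k IH] a.
  by apply: same_integral_ext (same_integral_exprn a) => x _; rewrite expr0 mulr1.
apply: same_integral_ext (same_integralB (IH a) (IH (a + n)%N)) => x _.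
by rewrite exprD exprS; ring.
Qed.

Lemma stieltjes_measure_ray (b : R) : 0 < b ->
  m1 `]b, +oo[%classic = m2 `]b, +oo[%classic.
Proof.
move=> b0; pose c := (b + 1)^-1.
have c01 : 0 < c < 1 by rewrite invr_gt0 addr_gt0//= invf_lt1 ?addr_gt0// ltrDr.
have : same_integral (fun x => (X x < c)%R%:R).
  apply: (@same_integral_cvg (fun n x => (1 - X x ^+ n) ^+ step_exponent c n) _ 1).
  - move=> n; apply: same_integral_ext (same_integral_bernstein 0 n _) => x _.
    by rewrite expr0 mul1r.
  - move=> n x x0; have Xn0 : 0 <= X x ^+ n by rewrite exprn_ge0// ltW// X0.
    have Xn1 : X x ^+ n <= 1 by rewrite exprn_ile1// ltW ?X0 ?X1.
    by rewrite ger0_norm ?exprn_ge0 ?exprn_ile1 ?subr_ge0// gerBl.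
  - by move=> x x0; apply: step_poly_cvg; rewrite // !ltW ?X0 ?X1.
case=> _ _ I.
have e (m : {measure set R -> \bar R}) : m D = 1%E ->
    (\int[m]_(x in D) (X x < c)%R%:R)%R = fine (m `]b, +oo[%classic).
  move=> mT; rewrite (@eq_Rintegral _ _ _ m D (\1_(`]b, +oo[%classic : set R))).
    rewrite /Rintegral integral_indic//.
    by rewrite setIidl//; apply: subset_itvr; rewrite bnd_simp ltW.
  move=> x; rewrite inE/= in_itv/= andbT => x0.
  rewrite indicE mem_setE in_itv/= andbT /X /c ltf_pV2 ?posrE ?addr_gt0//.
  by rewrite ltrD2r.
have fin (m : {measure set R -> \bar R}) : m D = 1%E -> m `]b, +oo[%classic \is a fin_num.
  move=> mT; rewrite ge0_fin_numE//; apply: le_lt_trans (_ : m D < +oo)%E.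
    apply: le_measure; rewrite ?inE//.
    by apply: subset_itvr; rewrite bnd_simp ltW.
  by rewrite mT ltry.
by move: I; rewrite !e// => h; rewrite -(fineK (fin m1 m1T)) h fineK ?fin.
Qed.

End stieltjes_unique.

(** * Measures given by an integrable density *)

Section density_measure.
Context d (T : measurableType d) (R : realType)
  (mu : {sigma_finite_measure set T -> \bar R}).
Local Open Scope ereal_scope.

(** Integrability and nonnegativity are arguments so that the structure of finite measure can be
    inferred from the term alone. *)
Definition density_measure (g : T -> R) of mu.-integrable setT (EFin \o g) &
  (forall x, (0 <= g x)%R) : set T -> \bar R := fun A => \int[mu]_(x in A) (g x)%:E.

Context (g : T -> R) (ig : mu.-integrable setT (EFin \o g)) (g0 : forall x, (0 <= g x)%R).
Local Notation nu := (density_measure ig g0).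

Let nu0 : nu set0 = 0. Proof. by rewrite /density_measure integral_set0. Qed.

Let nu_ge0 A : 0 <= nu A.
Proof. by rewrite /density_measure integral_ge0//= => x _; rewrite lee_fin. Qed.

Let nu_semi_sigma_additive : semi_sigma_additive nu.
Proof.
apply: (@semi_sigma_additive_nng_induced _ _ _ mu (EFin \o g)).
  exact: measurable_int ig.
by move=> x; rewrite lee_fin.
Qed.

HB.instance Definition _ := isMeasure.Build _ _ _ nu nu0 nu_ge0 nu_semi_sigma_additive.

Let nu_finite : fin_num_fun nu.
Proof.
by move=> A mA; apply: integrable_fin_num => //; exact: integrableS ig.
Qed.

HB.instance Definition _ := @Measure_isFinite.Build _ _ _ nu nu_finite.

(** Change of variables holds for the Radon-Nikodym derivative, and that derivative is almost
    everywhere [g], both having the same integral over every measurable set. *)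
Lemma integral_density_measure (f : T -> \bar R) (E : set T) :
  (forall x, 0 <= f x) -> measurable E -> measurable_fun E f ->
  \int[nu]_(x in E) f x = \int[mu]_(x in E) (f x * (g x)%:E).
Proof.
move=> f0 mE mf.
have numu : nu `<< mu.
  apply/null_content_dominatesP => A mA muA0.
  rewrite /density_measure; apply: null_set_integral => //.
  exact: measurable_funS (measurable_int _ ig).
rewrite -(Radon_Nikodym_SigmaFinite.change_of_variables numu)//.
have igE := integrableS measurableT mE (@subsetT _ E) ig.
have iRN := integrableS measurableT mE (@subsetT _ E)
  (Radon_Nikodym_SigmaFinite.f_integrable numu).
apply: ae_eq_integral => //.
- by apply: emeasurable_funM => //; exact: measurable_int iRN.
- by apply: emeasurable_funM => //; exact: measurable_int igE.
- apply: ae_eqe_mul2l; apply: integral_ae_eq => //; first exact: measurable_int igE.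
  by move=> A _ mA; rewrite -Radon_Nikodym_SigmaFinite.f_integral.
Qed.

End density_measure.

Section stieltjes_measure_unique.
Context (R : realType) (m1 m2 : {measure set R -> \bar R}).
Local Notation D := (`]0%R, +oo[%classic : set R).
Hypotheses (m1T : m1 setT = 1%E) (m2T : m2 setT = 1%E).
Hypotheses (m1D : m1 D = 1%E) (m2D : m2 D = 1%E).
Hypothesis stieltjes : forall s : R, 0 < s ->
  (\int[m1]_(x in D) (x / (x + s)) = \int[m2]_(x in D) (x / (x + s)))%R.

(** Open rays form a generating family stable under intersection. Those starting at b > 0 are
    settled by the Stieltjes transform; those starting at b <= 0 have mass 1 for both measures. *)
Lemma stieltjes_measure_unique (A : set R) : measurable A -> m1 A = m2 A.
Proof.
have ray (m : {measure set R -> \bar R}) (b : R) : m setT = 1%E -> m D = 1%E -> b <= 0 ->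
    m `]b, +oo[%classic = 1%E.
  move=> mT mD b0; apply/eqP; rewrite eq_le; apply/andP; split.
    by rewrite -mT le_measure ?inE.
  by rewrite -mD le_measure ?inE//; apply: subset_itvr; rewrite bnd_simp.
apply: (measure_unique (@RGenOInfty.G R) (fun k => `](- k%:R), +oo[%classic)).
- exact: RGenOInfty.measurableE.
- move=> _ _ [x ->] [y ->]; exists (Num.max x y).
  by apply/seteqP; split => z /=; rewrite !in_itv/= !andbT gt_max => /andP.
- by move=> k; exists (- k%:R).
- apply/seteqP; split => // x _; exists (Num.truncn `|x|).+1 => //=.
  rewrite in_itv/= andbT ltrNl; apply: le_lt_trans (truncnS_gt _).
  by rewrite ler_normr lexx orbT.
- move=> _ [b ->]; have [b0|b0] := leP b 0.
    by rewrite (ray m1 b m1T m1D b0) (ray m2 b m2T m2D b0).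
  exact: stieltjes_measure_ray.
- move=> k; have k0 : - k%:R <= 0 :> R by rewrite oppr_le0.
  by rewrite (ray m1 _ m1T m1D k0) ltry.
Qed.

End stieltjes_measure_unique.

(** * Expectation of a product under independence *)

Section independent_product.
Context d (T : measurableType d) (R : realType) (P : probability T R).

(** Independence says that the joint law agrees with the product of the laws on rectangles, hence
    everywhere; Tonelli then splits the integral. *)
Lemma independent_integralM (X Y : {RV P >-> R}) (f g : R -> R) :
  independent_RV X Y -> measurable_fun setT f -> measurable_fun setT g ->
  (forall x, 0 <= f x) -> (forall x, 0 <= g x) ->
  (\int[P]_t (f (X t) * g (Y t))%:E =
   (\int[P]_t (f (X t))%:E) * \int[P]_t (g (Y t))%:E)%E.
Proof.
move=> XY mf mg f0 g0.
pose XYf t := (X t, Y t).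
have mXY : measurable_fun setT XYf by apply: measurable_fun_pair.
pose XYm : {mfun T >-> (R * R)%type} :=
  HB.pack XYf (isMeasurableFun.Build _ _ _ _ XYf mXY).
pose h (z : R * R) := (f z.1 * g z.2)%:E.
have mh : measurable_fun setT h.
  apply/measurable_EFinP; apply: measurable_funM.
    exact: (measurableT_comp mf).
  exact: (measurableT_comp mg).
have h0 z : (0 <= h z)%E by rewrite lee_fin mulr_ge0.
transitivity (\int[distribution P XYm]_z h z)%E.
  by rewrite ge0_integral_distribution.
transitivity (\int[distribution P X \x distribution P Y]_z h z)%E.
  apply: eq_measure_integral => A mA _; apply/esym.
  by apply: product_measure_unique => //= A' B' mA' mB'; rewrite -XY.
rewrite fubini_tonelli1// /fubini_F /h /=.
have mfE : measurable_fun setT (EFin \o f) by exact/measurable_EFinP.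
have mgE : measurable_fun setT (EFin \o g) by exact/measurable_EFinP.
under eq_integral => x _.
  under eq_integral do rewrite EFinM.
  rewrite ge0_integralZl//; last first.
    by rewrite lee_fin.
    by move=> y _; rewrite lee_fin.
  over.
rewrite ge0_integralZr//; last 2 first.
- by move=> x _; rewrite lee_fin.
- by apply: integral_ge0 => y _; rewrite lee_fin.
have law (V : {RV P >-> R}) (k : R -> R) : measurable_fun setT (EFin \o k) ->
    (forall x, 0 <= k x) ->
    (\int[distribution P V]_x (k x)%:E = \int[P]_t (k (V t))%:E)%E.
  by move=> mk k0; apply: (ge0_integral_distribution V mk) => x; rewrite lee_fin.
by congr (_ * _)%E; exact: law.
Qed.

End independent_product.

(** * The law of the ratio *)

Section stable_laplace.
Context d (T : measurableType d) (R : realType) (P : probability T R) (alpha : R).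
Hypotheses (alpha0 : 0 < alpha) (alpha1 : alpha < 1).
Local Notation mu := (@lebesgue_measure R).

Lemma is_derive_stable_laplace (k t : R) : 0 < t ->
  is_derive t 1 (fun t => expR (- (k * t `^ alpha)))
    (- (k * alpha * t `^ (alpha - 1) * expR (- (k * t `^ alpha)))).
Proof.
move=> t0; have d1 := is_derive1_powR alpha t0.
have d2 : is_derive t 1 (fun t => - (k * t `^ alpha)) (- (k * (alpha * t `^ (alpha - 1)))).
  exact: (is_deriveN (is_deriveZ k d1)).
have := @is_derive1_comp _ expR (fun t => - (k * t `^ alpha)) t _ _ (is_derive_expR _) d2.
by move=> d3; apply: (is_derive_eq d3); ring.
Qed.

(* [h |-> E(e^(-(t+h)U)) + h E(U e^(-tU))] is minimal at [h = 0], since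
   [e^(-hU) >= 1 - hU]. *)
Lemma stable_mean_expR (U : T -> R) (t : R) : measurable_fun setT U ->
  (forall w, 0 <= U w) ->
  (forall l, 0 <= l -> (\int[P]_w (expR (- (l * U w)))%:E = (expR (- (l `^ alpha)))%:E)%E) ->
  0 < t ->
  (\int[P]_w (U w * expR (- (t * U w)))%:E =
   (alpha * t `^ (alpha - 1) * expR (- (t `^ alpha)))%:E)%E.
Proof.
move=> mU U0 LU t0.
have me (l : R) : measurable_fun setT (fun w => (expR (- (l * U w)))%:E).
  apply/measurable_EFinP; apply: measurableT_comp => //.
  apply: measurableT_comp => //; exact: measurable_funM.
have mUe : measurable_fun setT (fun w => (U w * expR (- (t * U w)))%:E).
  by apply/measurable_EFinP; apply: measurable_funM => //; apply/measurable_EFinP; exact: me.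
set M := (\int[P]_w (U w * expR (- (t * U w)))%:E)%E.
have M0 : (0 <= M)%E.
  by apply: integral_ge0 => w _; rewrite lee_fin mulr_ge0 ?expR_ge0.
have e0 (l : R) w : setT w -> (0 <= (expR (- (l * U w)))%:E)%E.
  by move=> _; rewrite lee_fin expR_ge0.
have pt (h : R) w : (1 - h * U w) * expR (- (t * U w)) <= expR (- ((t + h) * U w)).
  rewrite [(t + h) * _]mulrDl opprD expRD [leRHS]mulrC ler_wpM2r ?expR_ge0//.
  by have := expR_ge1Dx (- (h * U w)).
have hM (h : R) : 0 <= h -> (\int[P]_w (h * (U w * expR (- (t * U w))))%:E = h%:E * M)%E.
  move=> h0; under eq_integral do rewrite EFinM.
  rewrite ge0_integralZl//.
  by move=> w _; rewrite lee_fin mulr_ge0 ?expR_ge0.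
(* The inequality for h = - k, and [down] for h >= 0, are arranged so that only nonnegative
   functions are integrated: [M] is not yet known to be finite. *)
have up (k : R) : 0 <= k -> k <= t ->
    (k%:E * M + (expR (- (t `^ alpha)))%:E <= (expR (- ((t - k) `^ alpha)))%:E)%E.
  move=> k0 kt; have tk0 : 0 <= t - k by rewrite subr_ge0.
  rewrite -(LU t (ltW t0)) -(LU (t - k) tk0) -(hM k k0) -ge0_integralD//.
  - apply: ge0_le_integral => //.
    + by move=> w _; rewrite adde_ge0 ?lee_fin ?expR_ge0// mulr_ge0// mulr_ge0 ?expR_ge0.
    + apply: emeasurable_funD => //.
      under eq_fun do rewrite EFinM; exact: measurable_funeM.
    + move=> w _; rewrite -EFinD lee_fin; have := pt (- k) w.
      by rewrite mulNr opprK mulrDl mul1r addrC mulrA.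
  - by move=> w _; rewrite lee_fin mulr_ge0// mulr_ge0 ?expR_ge0.
  - by under eq_fun do rewrite EFinM; exact: measurable_funeM.
(* Taking k = t in [up] bounds t M by a finite value. *)
have Mfin : M \is a fin_num.
  rewrite ge0_fin_numE// ltey; apply/eqP => Moo.
  have := up t (ltW t0) (lexx _).
  by rewrite Moo gt0_muley ?lte_fin// addye.
have down (h : R) : 0 <= h ->
    ((expR (- (t `^ alpha)))%:E <= (expR (- ((t + h) `^ alpha)))%:E + h%:E * M)%E.
  move=> h0; have th0 : 0 <= t + h by rewrite addr_ge0// ltW.
  rewrite -(LU t (ltW t0)) -(LU (t + h) th0) -(hM h h0) -ge0_integralD//.
  - apply: ge0_le_integral => //.
    + apply: emeasurable_funD => //.
      under eq_fun do rewrite EFinM; exact: measurable_funeM.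
    + move=> w _; rewrite -EFinD lee_fin -lerBlDr; have := pt h w.
      by rewrite mulrBl mul1r mulrA.
  - by move=> w _; rewrite lee_fin mulr_ge0// mulr_ge0 ?expR_ge0.
  - by under eq_fun do rewrite EFinM; exact: measurable_funeM.
pose m := fine M; have mE : M = m%:E by rewrite fineK.
rewrite mE; congr EFin.
pose G (x : R) := expR (- (1 * x `^ alpha)) + (x - t) * m.
have dG (x : R) : 0 < x -> is_derive x 1 G
    (- (1 * alpha * x `^ (alpha - 1) * expR (- (1 * x `^ alpha))) + m).
  move=> x0; have d1 := is_derive_stable_laplace 1 x0.
  have d2 : is_derive x 1 (fun x => (x - t) * m) m.
    by apply: is_derive_eq; rewrite /GRing.scale/=; ring.
  exact: is_deriveD.
have t2 : t / 2 < t < t * 2 by apply/andP; split; lra.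
have dG0 : is_derive t 1 G 0.
  apply: (@derive1_at_min _ G (t / 2) (t * 2)); first lra.
  - move=> x; rewrite in_itv/= => /andP[x1 _].
    by have := dG x (lt_trans (divr_gt0 t0 (ltr0Sn R 1)) x1) => -[].
  - by rewrite in_itv.
  - move=> x; rewrite in_itv/= => /andP[x1 x2].
    rewrite /G subrr mul0r addr0 !mul1r.
    have [tx|xt] := leP t x.
      have := down (x - t); rewrite subr_ge0 => /(_ tx).
      by rewrite [t + _]addrC subrK mE -EFinM -EFinD lee_fin.
    have x0 : 0 <= x by apply: ltW; apply: lt_trans x1; rewrite divr_gt0.
    have := up (t - x); rewrite subr_ge0 gerBl => /(_ (ltW xt) x0).
    rewrite subKr mE -EFinM -EFinD lee_fin.
    by rewrite -[x - t]opprB mulNr addrC => h; rewrite lerBrDr.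
have := @derive_val _ _ _ _ _ _ _ (dG t t0); have := @derive_val _ _ _ _ _ _ _ dG0.
by move=> -> /eqP; rewrite !mul1r eq_sym addrC subr_eq0 => /eqP.
Qed.

Let cvg_expRN (c : R) (f : R -> R) (F : set_system R) {FF : Filter F} :
  0 < c -> f x @[x --> F] --> +oo%R -> expR (- (c * f x)) @[x --> F] --> (0 : R).
Proof.
move=> c0 fF; have h : c * f x @[x --> F] --> +oo.
  by apply: gt0_cvgMry => //; exact: cvg_cst.
exact: cvg_comp h (@cvgr_expR R).
Qed.

Lemma integral_0y_expR (u c : R) : 0 <= u -> 0 < c ->
  (\int[mu]_(t in `]0%R, +oo[) (u * expR (- (c * t)))%:E = (u / c)%:E)%E.
Proof.
move=> u0 c0; rewrite (_ : u / c = - (u / c) * 0 - - (u / c) * 1); last by ring.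
have dc (x : R) : is_derive x 1 (fun t => expR (- (c * t))) (- (c * expR (- (c * x)))).
  have d1 : is_derive x 1 (fun t => - (c * t)) (- c).
    by apply: is_derive_eq; rewrite /GRing.scale/=; ring.
  have := @is_derive1_comp _ expR (fun t => - (c * t)) x _ _ (is_derive_expR _) d1.
  by move=> d2; apply: (is_derive_eq d2); ring.
have cc (x : R) : {for x, continuous (fun t => expR (- (c * t)))}.
  by have d1 := dc x; apply/differentiable_continuous/derivable1_diffP.
apply: (@ge0_integral_0y _ (fun t => u * expR (- (c * t)))
   (fun t => - (u / c) * expR (- (c * t))) 1).
- by move=> x _; rewrite mulr_ge0 ?expR_ge0.
- by move=> x _; apply: cvgMl_tmp; exact: cc.
- by move=> x _; apply: cvgMl_tmp; exact: cc.
- move=> x _ _; apply: (is_derive_eq (is_deriveZ _ (dc x))).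
  by rewrite /GRing.scale/=; field; rewrite gt_eqF.
- apply: cvgMl_tmp; apply: cvg_at_right_filter.
  have e : expR (- (c * 0)) = 1 by rewrite mulr0 oppr0 expR0.
  by rewrite -[X in _ --> X]e; exact: cc.
- by apply: cvgMl_tmp; apply: cvg_expRN => //; exact: cvg_id.
Qed.

Lemma integral_0y_powR_expR (c : R) : 0 < c ->
  (\int[mu]_(t in `]0%R, +oo[) (alpha * t `^ (alpha - 1) * expR (- (c * t `^ alpha)))%:E
   = (c^-1)%:E)%E.
Proof.
move=> c0; rewrite (_ : c^-1 = - c^-1 * 0 - - c^-1 * 1); last by ring.
have cp b (x : R) : 0 < x -> {for x, continuous (fun x => x `^ b)}.
  move=> x0; apply/differentiable_continuous/derivable1_diffP.
  by apply: derivable_powR; rewrite in_itv/= x0.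
have cc (x : R) : 0 < x -> {for x, continuous (fun t => expR (- (c * t `^ alpha)))}.
  move=> x0; have d1 := is_derive_stable_laplace c x0.
  exact/differentiable_continuous/derivable1_diffP.
apply: (@ge0_integral_0y _ (fun t => alpha * t `^ (alpha - 1) * expR (- (c * t `^ alpha)))
   (fun t => - c^-1 * expR (- (c * t `^ alpha))) 1).
- by move=> x _; rewrite !mulr_ge0 ?expR_ge0 ?powR_ge0// ltW.
- move=> x x0; apply: cvgM; last exact: cc.
  by apply: cvgMl_tmp; exact: cp.
- by move=> x x0; apply: cvgMl_tmp; exact: cc.
- move=> x x0 _; apply: (is_derive_eq (is_deriveZ _ (is_derive_stable_laplace c x0))).
  by rewrite /GRing.scale/=; field; rewrite gt_eqF.
- apply: cvgMl_tmp.
  have h : - (c * t `^ alpha) @[t --> 0^'+] --> (- (c * 0) : R).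
    by apply: cvgN; apply: cvgMl_tmp; exact: powR_cvg0.
  rewrite mulr0 oppr0 in h; rewrite -[X in _ --> X](expR0 R).
  exact: (cvg_comp _ _ h (@continuous_expR R 0)).
- apply: cvgMl_tmp; apply: cvg_expRN => //.
  apply/cvgryPge => A; near=> t.
  have t1 : Num.max A 1 `^ alpha^-1 <= t by near: t; apply: nbhs_pinfty_ge; exact: num_real.
  rewrite (@le_trans _ _ (Num.max A 1))//; first by rewrite le_max lexx.
  have m0 : 0 <= Num.max A 1 by rewrite le_max ler01 orbT.
  rewrite -[leLHS](powRr1 m0) -(mulVf (lt0r_neq0 alpha0)) powRrM.
  by rewrite ge0_ler_powR// ?nnegrE ?powR_ge0// ?(ltW alpha0)// (le_trans _ t1)// powR_ge0.
Unshelve. all: by end_near. Qed.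

End stable_laplace.

(* The default measurable structure on [R] and [measurableTypeR R], which carries the
   Lebesgue measure, have the same measurable sets but different displays. *)
Lemma measure_default_display (R : realType)
    (nu : {measure set (measurableTypeR R) -> \bar R}) :
  exists m : {measure set R -> \bar R}, (forall A, m A = nu A) /\
    forall k : R -> \bar R, measurable_fun setT k -> (forall x, 0%E <= k x)%E ->
      (\int[m]_x k x = \int[nu]_x k x)%E.
Proof.
have mid : measurable_fun setT (idfun : measurableTypeR R -> R) by exact: measurable_id.
exists (measure_function_pushforward__canonical__measure_function_Measure nu mid); split => //.
by move=> k mk k0; rewrite ge0_integral_pushforward// preimage_setT.
Qed.

(** * Identification of the law of the ratio *)

Section stable_ratio_law.
Context d (T : measurableType d) (R : realType) (P : probability T R) (alpha : R).
Hypotheses (alpha0 : 0 < alpha) (alpha1 : alpha < 1).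
Context (Z Z' : {RV P >-> R}).
Hypotheses (Z_stable : positive_stable alpha Z) (Z'_stable : positive_stable alpha Z').
Hypothesis ZZ'_indep : independent_RV Z Z'.
Local Notation mu := (@lebesgue_measure R).
Local Notation D := (`]0%R, +oo[%classic : set R).

(** The stable variables are positive only almost surely; their positive parts make all integrands
    nonnegative everywhere, as Tonelli requires. *)
Let pos (x : R) : R := Num.max x 0.

Let pos_ge0 x : 0 <= pos x. Proof. by rewrite le_max lexx orbT. Qed.

Let pos_id x : 0 < x -> pos x = x. Proof. by move=> x0; rewrite /pos max_l// ltW. Qed.

Let mpos : measurable_fun setT pos.
Proof. by apply: measurable_maxr. Qed.

Let mposX (X : {RV P >-> R}) : measurable_fun setT (fun w => pos (X w)).
Proof. by apply: measurableT_comp. Qed.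

Lemma positive_stable_laplace (X : {RV P >-> R}) (l : R) : positive_stable alpha X ->
  0 <= l -> (\int[P]_w (expR (- (l * pos (X w))))%:E = (expR (- (l `^ alpha)))%:E)%E.
Proof.
move=> [X0 XL] l0; rewrite -XL// unlock.
apply: ae_eq_integral => //.
- apply/measurable_EFinP; apply: measurableT_comp => //; apply: measurableT_comp => //.
  by apply: measurable_funM => //; exact: mposX.
- apply/measurable_EFinP; apply: measurableT_comp => //; apply: measurableT_comp => //.
  exact: measurable_funM.
- by apply: filterS X0 => w Xw _; rewrite pos_id.
Qed.

(** The indicator puts the restriction t > 0 inside the integrand, so that Tonelli is applied on the
    full product space. *)
Let kernel s (z : T * R) : R :=
  pos (Z z.1) * expR (- (z.2 * pos (Z z.1))) * expR (- (z.2 * s * pos (Z' z.1))) * \1_D z.2.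

Let mkernel s : measurable_fun setT (EFin \o kernel s).
Proof.
have m1 (X : {RV P >-> R}) : measurable_fun setT (fun z : T * R => pos (X z.1)).
  exact: (measurableT_comp (mposX X)).
apply/measurable_EFinP; apply: measurable_funM; last first.
  have mI : measurable_fun setT (\1_D : R -> R) by exact: measurable_indic.
  exact: (measurableT_comp mI).
apply: measurable_funM; first apply: measurable_funM => //.
- apply: measurableT_comp => //; apply: measurableT_comp => //.
  by apply: measurable_funM.
- apply: measurableT_comp => //; apply: measurableT_comp => //.
  by apply: measurable_funM => //; apply: measurable_funM.
Qed.

Let kernel_ge0 s z : 0 <= kernel s z.
Proof. by rewrite /kernel !mulr_ge0 ?expR_ge0. Qed.

Let kernelE_ge0 s z : (0 <= (EFin \o kernel s) z)%E.
Proof. by rewrite /= lee_fin. Qed.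

Let int_indic (f : R -> R) :
  (\int[mu]_t (f t * \1_D t)%:E = \int[mu]_(t in D) (f t)%:E)%E.
Proof.
rewrite [RHS]integral_mkcond; apply: eq_integral => t _.
rewrite patchE indicE; case: (t \in D) => /=; first by rewrite mulr1.
by rewrite mulr0.
Qed.

Lemma stable_ratio_stieltjes s : 0 < s ->
  (\int[P]_w (pos (Z w) / (pos (Z w) + s * pos (Z' w)))%:E = ((1 + s `^ alpha)^-1)%:E)%E.
Proof.
move=> s0.
transitivity (\int[P]_w \int[mu]_t (kernel s (w, t))%:E)%E.
  apply: ae_eq_integral => //.
  - apply/measurable_EFinP; apply: measurable_funM; first exact: mposX.
    apply: (measurableT_comp (@measurable_inv_real R)).
    by apply: measurable_funD; [exact: mposX|apply: measurable_funM => //; exact: mposX].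
  - exact: (@measurable_fun_fubini_tonelli_F _ _ _ _ _ mu _ (mkernel s) (kernelE_ge0 s)).
  - have [Z0 _] := Z_stable; have [Z'0 _] := Z'_stable.
    move: Z0 Z'0; apply: filterS2 => w Zw Z'w _.
    rewrite /kernel/= !pos_id// int_indic.
    have c0 : 0 < Z w + s * Z' w by rewrite addr_gt0// mulr_gt0.
    rewrite -(integral_0y_expR (ltW Zw) c0).
    apply: eq_integral => t _; congr EFin.
    by rewrite -mulrA -expRD; congr (_ * expR _); ring.
(* For fixed t, independence factors the inner expectation, giving alpha t^(alpha-1) e^(-t^alpha)
   times e^(-(ts)^alpha). *)
rewrite (fubini_tonelli (m1 := P) (m2 := mu) _ (mkernel s) (kernelE_ge0 s))/=.
transitivity (\int[mu]_(t in D) (alpha * t `^ (alpha - 1) *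
    expR (- ((1 + s `^ alpha) * t `^ alpha)))%:E)%E; last first.
  by rewrite integral_0y_powR_expR// addr_gt0// powR_gt0.
rewrite -int_indic; apply: eq_integral => t _.
rewrite /kernel/=.
have [tD|tD] := boolP (t \in D); last first.
  rewrite indicE (negbTE tD) mulr0.
  by under eq_integral do rewrite mulr0; rewrite integral0.
rewrite indicE tD mulr1; under eq_integral do rewrite mulr1.
have t0 : 0 < t by move: tD; rewrite inE/= in_itv/= andbT.
pose f x := pos x * expR (- (t * pos x)).
pose g x := expR (- (t * s * pos x)).
rewrite (independent_integralM (f := f) (g := g) ZZ'_indep); last 4 first.
- apply: measurable_funM => //; apply: measurableT_comp => //; apply: measurableT_comp => //.
  exact: measurable_funM.
- apply: measurableT_comp => //; apply: measurableT_comp => //; exact: measurable_funM.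
- by move=> x; rewrite mulr_ge0 ?expR_ge0.
- by move=> x; exact: expR_ge0.
have ts0 : 0 <= t * s by rewrite mulr_ge0 ?ltW.
rewrite /f /g (positive_stable_laplace Z'_stable ts0).
rewrite (stable_mean_expR (mposX Z) (fun w => pos_ge0 (Z w))
  (fun l => positive_stable_laplace Z_stable) t0).
rewrite -EFinM; congr EFin; rewrite -[LHS]mulrA -expRD powRM ?ltW//.
by congr (_ * expR _); ring.
Qed.

Local Notation f := (stable_ratio_density alpha : R -> R).

Let f_ge0 x : D x -> 0 <= f x.
Proof. by rewrite /= in_itv/= andbT => x0; exact/ltW/stable_ratio_density_gt0. Qed.

Let mf : measurable_fun D f.
Proof.
apply: open_continuous_measurable_fun; first exact: interval_open.
move=> x; rewrite inE/= in_itv/= andbT => x0.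
exact: continuous_stable_ratio_density.
Qed.

Let mW s : 0 < s -> measurable_fun D (fun x => x / (x + s)).
Proof.
move=> s0; apply: measurable_funM => //.
by apply: (measurableT_comp (@measurable_inv_real R)); exact: measurable_funD.
Qed.

(** Let s decrease to 0 in the Stieltjes transform: x / (x + s) increases to 1, and 1 / (1 +
    s^alpha) tends to 1. *)
Lemma integral_stable_ratio_density : (\int[mu]_(x in D) (f x)%:E = 1)%E.
Proof.
pose s n : R := n.+1%:R^-1.
pose g n x := (f x * (x / (x + s n)))%:E.
have s0 n : 0 < s n by rewrite invr_gt0.
have h1 : (\int[mu]_(x in D) g n x @[n --> \oo] --> \int[mu]_(x in D) (f x)%:E)%E.
  have glim x : D x -> (g n x @[n --> \oo] --> (f x)%:E)%E.
    move=> Dx; have x0 : 0 < x by move: Dx; rewrite /= in_itv/= andbT.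
    apply: cvg_EFin; first exact: nearW.
    rewrite -[X in _ --> X]mulr1 -[X in _ * X](divff (lt0r_neq0 x0)).
    apply: cvgMl_tmp; apply: cvgMl_tmp; apply: cvgV; first by rewrite gt_eqF.
    by rewrite -[X in _ --> X]addr0; apply: cvgD; [exact: cvg_cst|exact: cvg_harmonic].
  rewrite (_ : (\int[mu]_(x in D) (f x)%:E = \int[mu]_(x in D) limn (g^~ x))%E); last first.
    by apply: eq_integral => x; rewrite inE => Dx; apply/esym/cvg_lim => //; exact: glim.
  apply: cvg_monotone_convergence => //.
  - by move=> n; apply/measurable_EFinP; apply: measurable_funM => //; exact: mW.
  - move=> n x Dx; rewrite lee_fin mulr_ge0 ?f_ge0//.
    by move: Dx; rewrite /= in_itv/= andbT => x0; rewrite divr_ge0 ?addr_ge0 ?ltW.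
  - move=> x Dx m n mn; rewrite lee_fin ler_wpM2l ?f_ge0//.
    move: Dx; rewrite /= in_itv/= andbT => x0; rewrite ler_wpM2l ?(ltW x0)//.
    rewrite lef_pV2 ?posrE ?addr_gt0// lerD2l lef_pV2 ?posrE//.
    by rewrite ler_nat.
have h2 : (\int[mu]_(x in D) g n x @[n --> \oo] --> 1%:E)%E.
  rewrite (_ : (fun n => _) = (fun n => ((1 + s n `^ alpha)^-1)%:E)); last first.
    by apply/funext => n; rewrite stieltjes_stable_ratio_density.
  apply: cvg_EFin; first exact: nearW.
  have h0 : s n `^ alpha @[n --> \oo] --> (0 : R).
    have := powR_cvg0 alpha0 => /cvg_at_rightP; apply; split => //.
    exact: cvg_harmonic.
  have h1' : 1 + s n `^ alpha @[n --> \oo] --> (1 + 0 : R).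
    by apply: cvgD => //; exact: cvg_cst.
  rewrite addr0 in h1'.
  have h3 : (1 + s n `^ alpha)^-1 @[n --> \oo] --> (1^-1 : R).
    by apply: cvgV => //; rewrite oner_neq0.
  by rewrite invr1 in h3.
exact: (@cvg_unique _ (@ereal_hausdorff R) _ _ _ _ h1 h2).
Qed.

Let g : R -> R := f \_ D.

Let g_ge0 x : 0 <= g x.
Proof. by rewrite /g patchE; case: ifP => // /set_mem; exact: f_ge0. Qed.

Let ig : mu.-integrable setT (EFin \o g).
Proof.
have mg : measurable_fun setT g by apply/(measurable_restrictT f (measurable_itv _)).
apply/integrableP; split; first exact/measurable_EFinP.
rewrite (_ : (\int[mu]_x _)%E = 1%E) ?ltry//.
rewrite -[RHS]integral_stable_ratio_density [RHS]integral_mkcond; apply: eq_integral => x _.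
by rewrite /g /= !patchE; case: ifP => [/set_mem/f_ge0 fx|_]; rewrite ?normr0// ger0_norm.
Qed.

Let Y_pos : {ae P, forall w, [/\ 0 < Z w, 0 < Z' w & 0 < ratio_RV Z Z' w]}.
Proof.
have [Z0 _] := Z_stable; have [Z'0 _] := Z'_stable.
by move: Z0 Z'0; apply: filterS2 => w Zw Z'w; split => //; exact: divr_gt0.
Qed.

Lemma stable_ratio_has_density : has_density_on_pos (ratio_RV Z Z') f.
Proof.
split; first exact: mf.
move=> A mA; pose m1 : {measure set R -> \bar R} := distribution P (ratio_RV Z Z').
have [m2 [m2nu im2]] := measure_default_display (density_measure ig g_ge0).
have m2E B : measurable B -> m2 B = (\int[mu]_(x in B `&` D) (f x)%:E)%E.
  move=> mB; rewrite m2nu integral_mkcondr; apply: eq_integral => x _.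
  by rewrite /g !patchE; case: ifP.
have mDD : measurable D by exact: measurable_itv.
have m1T : m1 setT = 1%E by exact: probability_setT.
have m1D : m1 D = 1%E.
  have mB : measurable (ratio_RV Z Z' @^-1` D).
    by rewrite -[X in measurable X]setTI; exact: measurable_funP.
  have P0 : P (~` (ratio_RV Z Z' @^-1` D)) = 0%E.
    apply: measure_negligible; first exact: measurableC.
    apply: negligibleS Y_pos => w /= nD [_ _ Yw]; apply: nD.
    by rewrite in_itv/= andbT.
  have := probability_setC P (measurableC mB).
  by rewrite setCK P0 sube0.
have m2D : m2 D = 1%E by rewrite m2E// setIid integral_stable_ratio_density.
have m2T : m2 setT = 1%E by rewrite m2E// setTI integral_stable_ratio_density.
rewrite -m2E//; refine (@stieltjes_measure_unique R m1 m2 m1T m2T m1D m2D _ A mA) => s s0.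
pose k x := ((fun x => x / (x + s)) \_ D) x.
have k0 x : 0 <= k x.
  rewrite /k patchE; case: ifP => // /set_mem; rewrite /= in_itv/= andbT => x0.
  by rewrite divr_ge0 ?addr_ge0 ?ltW.
have mk : measurable_fun setT k by apply/(measurable_restrictT _ (measurable_itv _)); exact: mW.
have kE (m : {measure set R -> \bar R}) :
    (\int[m]_(x in D) (x / (x + s)))%R = fine (\int[m]_x (k x)%:E)%E.
  rewrite /Rintegral integral_mkcond; congr fine; apply: eq_integral => x _.
  by rewrite /k !patchE; case: ifP.
rewrite !kE; congr fine.
transitivity ((1 + s `^ alpha)^-1)%:E.
  rewrite ge0_integral_distribution; last 2 first.
  - exact/measurable_EFinP.
  - by move=> x; rewrite lee_fin.
  rewrite -(stable_ratio_stieltjes s0); apply: ae_eq_integral => //.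
  - by apply/measurable_EFinP; exact: (measurableT_comp mk).
  - apply/measurable_EFinP; apply: measurable_funM; first exact: mposX.
    apply: (measurableT_comp (@measurable_inv_real R)).
    by apply: measurable_funD; [exact: mposX|apply: measurable_funM => //; exact: mposX].
  - move: Y_pos; apply: filterS => w [Zw Z'w Yw] _; congr EFin.
    rewrite /= /k patchE ifT; last by rewrite inE/= in_itv/= andbT.
    rewrite !pos_id// /ratio_RV/= /ratio_fun; field.
    by rewrite !gt_eqF// addr_gt0// mulr_gt0.
rewrite im2; last 2 first.
- exact/measurable_EFinP.
- by move=> x; rewrite lee_fin.
rewrite integral_density_measure; [|by move=> x; rewrite lee_fin|by []|exact/measurable_EFinP].
rewrite -(stieltjes_stable_ratio_density alpha0 alpha1 s0) [LHS]integral_mkcond.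
apply: eq_integral => x _; rewrite /k /g !patchE; case: ifP => _.
  by rewrite -EFinM mulrC.
by rewrite mul0e.
Qed.

End stable_ratio_law.

(** * The case alpha > 1/2 *)

Section lebesgue_scale.
Context (R : realType) (c : R).
Hypothesis c0 : 0 < c.
Local Notation mu := (@lebesgue_measure R).

Let mc : measurable_fun setT ( *%R c : measurableTypeR R -> measurableTypeR R).
Proof. exact: measurable_funM. Qed.

Let nu : {measure set (measurableTypeR R) -> \bar R} :=
  measure_function_pushforward__canonical__measure_function_Measure mu mc.

Lemma lebesgue_measure_scale (A : set R) : measurable A ->
  mu A = (c%:E * mu ( *%R c @^-1` A))%E.
Proof.
have c0' : (0 <= c) by exact: ltW.
move=> mA; rewrite (@lebesgue_measure_unique R (mscale (NngNum c0') nu))//.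
move=> _ [[a b] _ <-].
have e : *%R c @^-1` `]a, b]%classic = `]a / c, b / c]%classic.
  by apply/seteqP; split => x /=; rewrite !in_itv/= ltr_pdivrMr// ler_pdivlMr// mulrC.
transitivity (c%:E * mu `](a / c)%R, (b / c)%R]%classic)%E; last by rewrite -e.
rewrite /= !lebesgue_measure_itv/= !lte_fin ltr_pM2r ?invr_gt0//.
case: ifPn => _; last by rewrite mule0.
by rewrite -!EFinB -EFinM -mulrBl mulrCA divff ?mulr1// gt_eqF.
Qed.

Lemma ae_lebesgue_scale (Q : R -> Prop) :
  {ae mu, forall x : R, Q x} -> {ae mu, forall x : R, Q (c * x)}.
Proof.
move=> [N [mN N0 QN]]; exists ( *%R c @^-1` N); split => //.
- by rewrite -[X in measurable X]setTI; exact: mc.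
- have /esym/eqP := lebesgue_measure_scale mN.
  by rewrite N0 mule_eq0 eqe gt_eqF//= => /eqP.
- by move=> x Qx; exact: QN.
Qed.

End lebesgue_scale.

Lemma ae_lebesgue_exists_gt (R : realType) (M : R) (Q : R -> Prop) :
  {ae @lebesgue_measure R, forall x : R, Q x} -> exists2 x, M < x & Q x.
Proof.
move=> [N [mN N0 QN]]; apply: contrapT => nQ.
have : (lebesgue_measure `]M, (M + 1)%R[%classic <= lebesgue_measure N)%E.
  rewrite le_measure ?inE// => x /=; rewrite in_itv/= => /andP[Mx _].
  by apply: QN => Qx; apply: nQ; exists x.
rewrite N0 lebesgue_measure_itv/= lte_fin ltrDl ltr01 -EFinB lee_fin.
by rewrite addrAC subrr add0r ler10.
Qed.

Section density_unique.
Context d (T : measurableType d) (R : realType) (P : probability T R).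
Local Notation D := (`]0%R, +oo[%classic : set R).
Local Notation mu := (@lebesgue_measure R).

(** Nonnegativity makes [f] integrable, the integral of its absolute value being a probability;
    equal integrals over all measurable sets then force equality almost everywhere. *)
Lemma has_density_on_pos_unique (X : {RV P >-> R}) (f g : R -> R) :
  (forall x, 0 < x -> 0 <= f x) ->
  has_density_on_pos X f -> has_density_on_pos X g ->
  {ae mu, forall x : R, 0 < x -> f x = g x}.
Proof.
move=> f0 [mf Xf] [mg Xg].
have mD : measurable D by exact: measurable_itv.
have : ae_eq mu D (EFin \o f) (EFin \o g).
  apply: integral_ae_eq => //.
  - apply/integrableP; split; first exact/measurable_EFinP.
    rewrite (_ : (\int[mu]_(x in D) _)%E = (\int[mu]_(x in D `&` D) (f x)%:E)%E).
      by rewrite -Xf// (le_lt_trans (probability_le1 _ _))// ltry.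
    rewrite setIid; apply: eq_integral => x; rewrite inE/= in_itv/= andbT => x0.
    by rewrite ger0_norm// f0.
  - exact/measurable_EFinP.
  - by move=> E ED mE; have := Xf E mE; rewrite Xg// setIidl.
by apply: filterS => x + x0; rewrite /= in_itv/= andbT => /(_ x0) [].
Qed.

End density_unique.

(** Take u = 2x. The points v = 1 and v = 2 give w = 2 and w = 5/2, and H is nonincreasing on the
    closed half-line, its continuity at 2 giving access to the endpoint. *)
Lemma hcm_function_mul_le (R : realType) (f : R -> R) x : hcm_function f -> 0 < x ->
  f x * f (4 * x) <= f (2 * x) ^+ 2.
Proof.
move=> [_ hf] x0; have x20 : 0 < 2 * x by rewrite mulr_gt0.
have [H [HE [cH dH]]] := hf _ x20.
have := HE 1 ltr01; rewrite invr1 !mulr1 => H2.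
have := HE 2 (ltr0n R 2); rewrite -mulrA [x * 2]mulrC mulrA [2 * x / 2]mulrAC divff// mul1r.
rewrite (_ : 2 * 2 * x = 4 * x); last by ring.
move=> H52; rewrite mulrC -H52 expr2 -H2.
apply: (@ler0_derive1_nincry _ H 2) => //.
- by move=> y; rewrite in_itv/= andbT => y2; have [] := dH 0%N y y2.
- move=> y; rewrite in_itv/= andbT => y2; have [_] := dH 1%N y y2.
  by rewrite expr1 mulN1r oppr_ge0.
- lra.
Qed.

(** * Failure of the inequality at large points *)

Section large_alpha.
Context (R : realType) (alpha : R).
Hypotheses (alpha2 : 1 / 2 < alpha) (alpha1 : alpha < 1).

Lemma cos_pi_lt0 : cos (pi * alpha) < 0 :> R.
Proof.
have p0 := pi_gt0 R; have h1 : pi / 2 < pi * alpha by rewrite ltr_pM2l// -[ltLHS]mul1r.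
have h2 : pi * alpha < pi by rewrite -[ltRHS]mulr1 ltr_pM2l.
by rewrite -(cos_pihalf R) ltr_cos ?in_itv/=//; apply/andP; split; lra.
Qed.

(** In the difference of the two sides the terms of degree 4 in X cancel, and the coefficient of X^3
    is - 2 cos(pi alpha) Q^2 (Q - 1)^2 > 0. The threshold makes this term dominate the only negative
    one, - (Q^2 - 1)^2 X^2. *)
Lemma stable_ratio_denom_lt (X Q : R) : 1 < Q ->
  (Q + 1) ^+ 2 / (- (2 * cos (pi * alpha))) < X ->
  stable_ratio_denom alpha X * stable_ratio_denom alpha (Q ^+ 2 * X) <
  stable_ratio_denom alpha (Q * X) ^+ 2.
Proof.
have := cos_pi_lt0; rewrite /stable_ratio_denom; move: (cos _) => a a0 Q1.
have e0 : 0 < - (2 * a) by lra.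
rewrite ltr_pdivrMr// => hX.
have X0 : 0 < X.
  have : 0 < X * - (2 * a) by apply: le_lt_trans hX; exact: sqr_ge0.
  by rewrite pmulr_lgt0.
rewrite -subr_gt0 (_ : _ - _ = (Q - 1) ^+ 2 * X *
   (X * (Q ^+ 2 * (X * - (2 * a)) - (Q + 1) ^+ 2) + - (2 * a))); last by ring.
have Q2 : 1 < Q ^+ 2 by rewrite exprn_egt1.
apply: mulr_gt0; first by rewrite mulr_gt0 ?exprn_gt0 ?subr_gt0.
apply: addr_gt0 => //; apply: mulr_gt0 => //; rewrite subr_gt0; apply: (lt_trans hX).
by rewrite ltr_pMl// mulr_gt0.
Qed.

(** The power prefactors at x and 4x multiply to the square of the one at 2x, so only the
    denominators matter; they are compared with X = x^alpha and Q = 2^alpha. *)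
Lemma stable_ratio_density_mul_gt : exists M : R, 0 < M /\ forall x, M < x ->
  stable_ratio_density alpha (2 * x) ^+ 2 <
  stable_ratio_density alpha x * stable_ratio_density alpha (4 * x).
Proof.
have a0 : 0 < alpha by apply: lt_trans alpha2; rewrite divr_gt0.
set B := (2 `^ alpha + 1) ^+ 2 / (- (2 * cos (pi * alpha))).
have B0 : 0 < B.
  rewrite divr_gt0// ?exprn_gt0 ?addr_gt0 ?powR_gt0//.
  by rewrite oppr_gt0 pmulr_rlt0 ?cos_pi_lt0.
exists (B `^ alpha^-1); split; first exact: powR_gt0.
move=> x Mx; have x0 : 0 < x by apply: lt_trans Mx; exact: powR_gt0.
have BX : B < x `^ alpha.
  rewrite -[ltLHS]powRr1 ?ltW// -[X in _ `^ X](@mulVf _ alpha) ?gt_eqF// powRrM.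
  by apply: gt0_ltr_powR; rewrite ?nnegrE ?ltW ?powR_gt0.
have Q1 : 1 < 2 `^ alpha :> R.
  have := @gt0_ltr_powR R alpha a0 1 2.
  by rewrite powR1 !nnegrE; apply => //; rewrite ltr1n.
have := stable_ratio_denom_lt Q1 BX.
have x2 : (2 * x) `^ alpha = 2 `^ alpha * x `^ alpha by rewrite powRM ?ltW.
have x4 : (4 * x) `^ alpha = (2 `^ alpha) ^+ 2 * x `^ alpha.
  by rewrite (_ : 4 * x = 2 * (2 * x)) ?powRM ?mulr_ge0 ?ltW//; ring.
have y2 : (2 * x) `^ (alpha - 1) = 2 `^ (alpha - 1) * x `^ (alpha - 1).
  by rewrite powRM ?ltW.
have y4 : (4 * x) `^ (alpha - 1) = (2 `^ (alpha - 1)) ^+ 2 * x `^ (alpha - 1).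
  by rewrite (_ : 4 * x = 2 * (2 * x)) ?powRM ?mulr_ge0 ?ltW//; ring.
rewrite /stable_ratio_density x2 x4 y2 y4.
have D0 t := stable_ratio_denom_gt0 t a0 alpha1.
have Dx := D0 (x `^ alpha); have D2x := D0 (2 `^ alpha * x `^ alpha).
have D4x := D0 ((2 `^ alpha) ^+ 2 * x `^ alpha).
have k0 : 0 < sin (pi * alpha) / pi * 2 `^ (alpha - 1) * x `^ (alpha - 1).
  have s0 := @sin_pi_gt0 R alpha a0 alpha1.
  by rewrite !mulr_gt0 ?invr_gt0 ?pi_gt0 ?powR_gt0.
move: Dx D2x D4x k0; set D := stable_ratio_denom alpha.
move: (D _) (D _) (D _) (sin _ / pi) (2 `^ (alpha - 1)) (x `^ (alpha - 1)).
move=> D3 D2 D1 k q y D1_gt0 D2_gt0 D3_gt0 k0 lt.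
rewrite (_ : _ ^+ 2 = (k * q * y) ^+ 2 * (D2 ^+ 2)^-1); last first.
  by field; rewrite gt_eqF.
rewrite [ltRHS](_ : _ = (k * q * y) ^+ 2 * (D1 * D3)^-1); last first.
  by field; rewrite !gt_eqF.
by rewrite ltr_pM2l ?exprn_gt0// ltf_pV2 ?posrE ?mulr_gt0 ?exprn_gt0.
Qed.


Lemma stable_ratio_not_hcm d (T : measurableType d) (P : probability T R) (X : {RV P >-> R}) :
  has_density_on_pos X (stable_ratio_density alpha) -> ~ hcm_RV X.
Proof.
have alpha0 : 0 < alpha by apply: lt_trans alpha2; rewrite divr_gt0.
move=> X0 [f [Xf hf]].
have [M [M0 fM]] := stable_ratio_density_mul_gt.
have fE := has_density_on_pos_unique (fun x x0 => ltW (hf.1 x x0)) Xf X0.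
have c2 : 0 < 2 :> R by rewrite ltr0n.
have c4 : 0 < 4 :> R by rewrite ltr0n.
(* The density is known only almost everywhere, whereas the inequality needs its values at x, 2x and
   4x; null sets are pulled back by the dilations so that one large x serves all three. *)
have fE2 := ae_lebesgue_scale c2 fE; have fE4 := ae_lebesgue_scale c4 fE.
have {fE fE2 fE4} fE : {ae @lebesgue_measure R, forall x : R, 0 < x ->
    [/\ f x = stable_ratio_density alpha x, f (2 * x) = stable_ratio_density alpha (2 * x) &
      f (4 * x) = stable_ratio_density alpha (4 * x)]}.
  have FF := ae_filter_ringOfSetsType (@lebesgue_measure R).
  move: fE fE2 fE4; apply: (@filterS3 _ _ FF) => x h1 h2 h4 x0.
  by rewrite h1 ?h2 ?h4 ?mulr_gt0.
have [x Mx] := ae_lebesgue_exists_gt M fE.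
have x0 := lt_trans M0 Mx; move=> /(_ x0)[f1 f2 f4].
have := hcm_function_mul_le hf x0.
by rewrite f1 f2 f4 leNgt fM.
Qed.

End large_alpha.

Unset Implicit Arguments.

Theorem corollary4p1 (d : measure_display) (T : measurableType d)
  (R : realType) (P : probability T R) (alpha : R)
  (alpha_gt0 : 0 < alpha) (alpha_lt1 : alpha < 1)
  (Z Z' : {RV P >-> R})
  (Z_stable : positive_stable alpha Z) (Z'_stable : positive_stable alpha Z')
  (ZZ'_law : same_law Z Z') (ZZ'_indep : independent_RV Z Z') :
  hcm_RV (ratio_RV Z Z') <-> alpha <= 1 / 2.
Proof.
have f0_density := stable_ratio_has_density alpha_gt0 alpha_lt1 Z_stable Z'_stable ZZ'_indep.
split=> [|alpha_le]; last first.
  by exists (stable_ratio_density alpha); split => //; exact: hcm_stable_ratio_density.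
rewrite leNgt => hY; apply/negP => alpha_gt.
exact: (stable_ratio_not_hcm alpha_gt alpha_lt1 f0_density).
Qed.
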